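(* Let $(B,M)$ be a reduced local ring containing the rationals, with $B/M$ uncountable and $|B| = |B/M|$. Suppose the set $\mathrm{Min}(B)$ of minimal prime ideals of $B$ is partitioned into $m \geq 1$ subcollections $C_1, \ldots, C_m$. Then there is a reduced local ring $S \subseteq B$ (a subring of $B$) with maximal ideal $S \cap M$ such that: (1) $S$ contains the rationals; (2) $\widehat{S} = \widehat{B}$; (3) $S/(S \cap M)$ is uncountable and $|S| = |S/(S \cap M)|$; (4) for $Q, Q' \in \mathrm{Min}(B)$, $Q \cap S = Q' \cap S$ if and only if there is an $i \in \{1,2,\ldots,m\}$ with $Q \in C_i$ and $Q' \in C_i$; (5) the map $f : \mathrm{Spec}(B) \to \mathrm{Spec}(S)$ given by $f(P) = S \cap P$ is onto and, if $P$ is a prime ideal of $B$ with positive height, then $f(P)B = P$. In particular, if $P$ and $P'$ are prime ideals of $B$ with positive height, then $f(P)$ has positive height, and $f(P) = f(P')$ implies $P = P'$.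
   Context: All rings are commutative with unity. A ring is quasi-local if it has exactly one maximal ideal, and local if it is both quasi-local and Noetherian; $(B,M)$ denotes a local ring $B$ with maximal ideal $M$. For a local ring $(R,N)$, $\widehat{R}$ denotes the $N$-adic completion. For a subring $S \subseteq B$ that is local with maximal ideal $S\cap M$, the equality $\widehat{S} = \widehat{B}$ means that the natural homomorphism $\widehat{S} \to \widehat{B}$ induced by the inclusion $S \subseteq B$ is an isomorphism. $|X|$ denotes the cardinality of $X$, and $f(P)B$ denotes the ideal of $B$ generated by $f(P)$. *)

(* Defs.v *)
From HB Require Import structures.
From mathcomp Require Import all_boot all_order all_algebra ring_quotient.
From mathcomp Require Import generic_quotient.
From mathcomp Require Import boolp classical_sets functions cardinality.
From mathcomp Require Import constructive_ereal.

Set Implicit Arguments.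
Unset Strict Implicit.
Unset Printing Implicit Defensive.
Import Order.TTheory GRing.Theory Num.Theory.

Local Open Scope classical_set_scope.
Local Open Scope ring_scope.
Local Open Scope quotient_scope.

(* Ideals are boolean predicates, as in ring_quotient.v.  The ideals of that
   file (idealr_closed, idealr) are the proper ones; every predicate is
   decidable here, by the classical axioms of boolp.v. *)

Definition ideal_gen (R : comNzRingType) (A : set R) : {pred R} :=
  fun x => `[< exists n (a y : 'I_n -> R),
    (forall i, A (y i)) /\ x = \sum_(i < n) a i * y i >].

(* Only proper ideals are tested: the unit ideal is generated by 1. *)
Definition noetherian (R : comNzRingType) : Prop :=
  forall I : {pred R}, idealr_closed I ->
    exists s : seq R, I =i ideal_gen [set` s].

Definition prime_ideal (R : comNzRingType) (P : {pred R}) : Prop :=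
  idealr_closed P /\ prime_idealr_closed P.

Definition maximal_ideal (R : comNzRingType) (M : {pred R}) : Prop :=
  idealr_closed M /\
  forall J : {pred R}, idealr_closed J -> {subset M <= J} -> J =i M.

Definition quasi_local (R : comNzRingType) (M : {pred R}) : Prop :=
  maximal_ideal M /\ forall J : {pred R}, maximal_ideal J -> J =i M.

Definition local_ring (R : comNzRingType) (M : {pred R}) : Prop :=
  quasi_local M /\ noetherian R.

Definition reduced (R : comNzRingType) : Prop :=
  forall (x : R) n, x ^+ n = 0 -> x = 0.

Definition contains_rationals (R : comNzRingType) : Prop :=
  exists g : {rmorphism rat -> R}, injective g.

Definition Spec (R : comNzRingType) : set {pred R} := [set P | prime_ideal P].

Definition MinSpec (R : comNzRingType) : set {pred R} :=
  [set P | Spec P /\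
    forall Q : {pred R}, Spec Q -> {subset Q <= P} -> Q =i P].

(* c 0 < c 1 < ... < c n = P *)
Definition prime_chain (R : comNzRingType) (P : {pred R}) (n : nat)
    (c : nat -> {pred R}) : Prop :=
  [/\ forall i, (i <= n)%N -> Spec (c i),
      forall i, (i < n)%N ->
        {subset c i <= c i.+1} /\ ~ {subset c i.+1 <= c i}
    & c n =i P].

Definition height (R : comNzRingType) (P : {pred R}) : \bar int :=
  supremum -oo%E [set n%:Z%:E%E | n in [set n | exists c, prime_chain P n c]].

Definition ideal_contr (S B : comNzRingType) (f : {rmorphism S -> B})
  (P : {pred B}) : {pred S} := fun s => f s \in P.

Lemma ideal_contr_idealr_closed (S B : comNzRingType) (f : {rmorphism S -> B})
  (P : idealr B) : idealr_closed (ideal_contr f P).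
Proof.
split.
- by rewrite unfold_in rmorph0; apply: idealr0.
- by apply/negP; rewrite unfold_in rmorph1 idealr1.
- move=> a u v uP vP; rewrite unfold_in rmorphD rmorphM.
  exact: rpredD (idealMr _ uP) vP.
Qed.

HB.instance Definition _ (S B : comNzRingType) (f : {rmorphism S -> B})
  (P : idealr B) := isIdealr.Build S (ideal_contr f P) (ideal_contr_idealr_closed f P).

Lemma ideal_genP (R : comNzRingType) (A : set R) x :
  reflect (exists n (a y : 'I_n -> R),
      (forall i, A (y i)) /\ x = \sum_(i < n) a i * y i)
    (x \in ideal_gen A).
Proof. exact: asboolP. Qed.

(* The power I^(n+1). *)
Definition ideal_powS (R : comNzRingType) (I : {pred R}) (n : nat) : {pred R} :=
  ideal_gen [set \prod_(i < n.+1) y i | y in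
    [set y : 'I_n.+1 -> R | forall i, y i \in I]].

Lemma ideal_genD (R : comNzRingType) (A : set R) a x y :
  x \in ideal_gen A -> y \in ideal_gen A -> a * x + y \in ideal_gen A.
Proof.
move=> /ideal_genP[n [b [u [Au ->]]]] /ideal_genP[m [c [v [Av ->]]]].
apply/ideal_genP; exists (n + m)%N.
exists (fun i => match fintype.split i with inl j => a * b j | inr j => c j end).
exists (fun i => match fintype.split i with inl j => u j | inr j => v j end).
split=> [i|]; first by case: fintype.split.
rewrite big_split_ord /= mulr_sumr; congr (_ + _); apply: eq_bigr => i _.
  by rewrite (unsplitK (inl i)) mulrA.
by rewrite (unsplitK (inr i)).
Qed.

Lemma ideal_powS_sub (R : comNzRingType) (I : idealr R) n :
  {subset ideal_powS I n <= I}.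
Proof.
move=> x /ideal_genP[m [a [y [Ay ->]]]]; apply: (@rpred_sum _ I) => i _.
by apply: idealMr; have [z zI <-] := Ay i; rewrite big_ord_recr idealMr.
Qed.

Lemma ideal_powS_le (R : comNzRingType) (I : {pred R}) n :
  {subset ideal_powS I n.+1 <= ideal_powS I n}.
Proof.
move=> x /ideal_genP[m [a [y [Ay ->]]]].
have /choice[z zP] : forall i, exists z : 'I_n.+2 -> R,
    (forall j, z j \in I) /\ \prod_j z j = y i.
  by move=> i; have [z zI zy] := Ay i; exists z.
apply/ideal_genP; exists m, (fun i => a i * z i ord0).
exists (fun i => \prod_(j < n.+1) z i (lift ord0 j)); split=> [i|].
  by exists (fun j => z i (lift ord0 j)) => //= j; apply: (zP i).1.
by apply: eq_bigr => i _; rewrite -(zP i).2 (big_ord_recl n.+1) mulrA.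
Qed.

Lemma ideal_powS_idealr_closed (R : comNzRingType) (I : idealr R) n :
  idealr_closed (ideal_powS I n).
Proof.
split.
- apply/ideal_genP; exists 0%N, (fun _ => 0), (fun _ => 0).
  by split=> [[]|] //; rewrite big_ord0.
- by apply/negP => /ideal_powS_sub; rewrite idealr1.
- by move=> a u v; apply: ideal_genD.
Qed.

HB.instance Definition _ (R : comNzRingType) (I : idealr R) n :=
  isIdealr.Build R (ideal_powS I n) (ideal_powS_idealr_closed I n).

(* R / I^(n+1) *)
Notation quot_pow I n := {ideal_quot (ideal_powS I n : idealr _)}.

(* The canonical surjection R / I^(n+2) -> R / I^(n+1). *)
Definition quot_pow_step (R : comNzRingType) (I : idealr R) n
  (x : quot_pow I n.+1) : quot_pow I n :=
  \pi_(quot_pow I n) (repr x).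

Lemma quot_pow_step_pi (R : comNzRingType) (I : idealr R) n (x : R) :
  quot_pow_step (\pi_(quot_pow I n.+1) x) = \pi_(quot_pow I n) x.
Proof.
apply/eqP; rewrite /quot_pow_step -Quotient.idealrBE ideal_powS_le //.
by rewrite Quotient.idealrBE reprK.
Qed.

Lemma quot_pow_step_zmod (R : comNzRingType) (I : idealr R) n :
  zmod_morphism (@quot_pow_step R I n).
Proof.
by move=> x y; rewrite -[x]reprK -[y]reprK -rmorphB !quot_pow_step_pi rmorphB.
Qed.

Lemma quot_pow_step_monoid (R : comNzRingType) (I : idealr R) n :
  monoid_morphism (@quot_pow_step R I n).
Proof.
split=> [|x y].
  by rewrite -(rmorph1 (\pi_(quot_pow I n.+1))) quot_pow_step_pi rmorph1.
by rewrite -[x]reprK -[y]reprK -rmorphM !quot_pow_step_pi rmorphM.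
Qed.

HB.instance Definition _ (R : comNzRingType) (I : idealr R) n :=
  GRing.isZmodMorphism.Build _ _ (@quot_pow_step R I n)
    (@quot_pow_step_zmod R I n).
HB.instance Definition _ (R : comNzRingType) (I : idealr R) n :=
  GRing.isMonoidMorphism.Build _ _ (@quot_pow_step R I n)
    (@quot_pow_step_monoid R I n).

(* The I-adic completion, as the inverse limit of the rings R / I^(n+1); the
   zero ring R / I^0 is left out, as {ideal_quot _} needs a proper ideal. *)
Record completion (R : comNzRingType) (I : idealr R) := Completion {
  comp_proj : forall n, quot_pow I n;
  comp_coherent : forall n, quot_pow_step (comp_proj n.+1) = comp_proj n }.

Section CompletionRing.
Context (R : comNzRingType) (I : idealr R).
Local Notation hatR := (completion I).
Implicit Types x y z : hatR.

Lemma completionP x y :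
  (forall n, comp_proj x n = comp_proj y n) -> x = y.
Proof.
case: x y => [x xP] [y yP] /= exy.
have {exy} exy : x = y by apply: functional_extensionality_dep.
by case: y / exy yP => yP; congr Completion; apply: Prop_irrelevance.
Qed.

HB.instance Definition _ := gen_eqMixin hatR.
HB.instance Definition _ := gen_choiceMixin hatR.

Definition comp_zero : hatR.
Proof. by exists (fun n => 0) => n; rewrite rmorph0. Defined.

Definition comp_one : hatR.
Proof. by exists (fun n => 1) => n; rewrite rmorph1. Defined.

Definition comp_opp x : hatR.
Proof.
by exists (fun n => - comp_proj x n) => n; rewrite rmorphN /= comp_coherent.
Defined.

Definition comp_add x y : hatR.
Proof.
exists (fun n => comp_proj x n + comp_proj y n) => n.
by rewrite rmorphD /= !comp_coherent.
Defined.

Definition comp_mul x y : hatR.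
Proof.
exists (fun n => comp_proj x n * comp_proj y n) => n.
by rewrite rmorphM /= !comp_coherent.
Defined.

Lemma comp_addA : associative comp_add.
Proof. by move=> x y z; apply: completionP => n; apply: addrA. Qed.
Lemma comp_addC : commutative comp_add.
Proof. by move=> x y; apply: completionP => n; apply: addrC. Qed.
Lemma comp_add0 : left_id comp_zero comp_add.
Proof. by move=> x; apply: completionP => n; apply: add0r. Qed.
Lemma comp_addN : left_inverse comp_zero comp_opp comp_add.
Proof. by move=> x; apply: completionP => n; apply: addNr. Qed.
Lemma comp_mulA : associative comp_mul.
Proof. by move=> x y z; apply: completionP => n; apply: mulrA. Qed.
Lemma comp_mulC : commutative comp_mul.
Proof. by move=> x y; apply: completionP => n; apply: mulrC. Qed.
Lemma comp_mul1 : left_id comp_one comp_mul.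
Proof. by move=> x; apply: completionP => n; apply: mul1r. Qed.
Lemma comp_mulDl : left_distributive comp_mul comp_add.
Proof. by move=> x y z; apply: completionP => n; apply: mulrDl. Qed.
Lemma comp_one_neq0 : comp_one != comp_zero.
Proof.
apply/eqP => /(congr1 (fun x => comp_proj x 0%N)) /eqP.
by rewrite /= oner_eq0.
Qed.

HB.instance Definition _ :=
  GRing.isZmodule.Build hatR comp_addA comp_addC comp_add0 comp_addN.
HB.instance Definition _ := GRing.Zmodule_isComNzRing.Build hatR
  comp_mulA comp_mulC comp_mul1 comp_mulDl comp_one_neq0.

End CompletionRing.

(* phi is the homomorphism of completions induced by f: at every level n it
   sends the class of r to the class of f r.  This determines phi. *)
Definition completion_map (S B : comNzRingType) (f : {rmorphism S -> B})
    (N : idealr S) (M : idealr B)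
    (phi : {rmorphism completion N -> completion M}) : Prop :=
  forall (x : completion N) n (r : S),
    comp_proj x n = \pi_(quot_pow N n) r ->
    comp_proj (phi x) n = \pi_(quot_pow M n) (f r).

Definition same_completion (S B : comNzRingType) (f : {rmorphism S -> B})
    (N : idealr S) (M : idealr B) : Prop :=
  exists phi : {rmorphism completion N -> completion M},
    completion_map f phi /\ bijective phi.

(* The ideal I B generated in B by the image of I. *)
Definition ideal_ext (S B : comNzRingType) (f : {rmorphism S -> B})
  (I : {pred S}) : {pred B} := ideal_gen (f @` [set` I]).

(* Main.v *)
(** Write Min(B) = {Q_1, ..., Q_n}.  Suppose that a subring R of B meets every
    Q_i in 0 and every coset b + aM with a regular.  For each class C_j, the
    image of R in the product of the fields Frac(B/Q_i), Q_i in C_j, generates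
    a field F_j, and S is the set of elements of B whose image lies in the
    product of the F_j.  An element of F_j vanishes at one Q_i of C_j only if
    it vanishes at all of them, which is the gluing.  As R is contained in S,
    and S contains b as soon as it contains ab and a regular element a,
    S/aS -> B/aB is an isomorphism for all regular a in S; this gives the
    completion, the Noetherian property and the primes of positive height.

    R is generated by a transfinite sequence x = b + acy, one term for each pair
    (b, a), with c in M regular.  The element y is chosen so that no nonzero
    polynomial over the ring generated by the previous terms has x as a root
    modulo some Q_i.  Each polynomial excludes finitely many residue classes of
    y, and there are fewer polynomials than classes because B/M is uncountable
    and the sequence has order type at most |B/M|.  When M has no regular
    element, B is a field and R = B. *)

Require Import Defs.
From HB Require Import structures.
From mathcomp Require Import all_boot all_order all_algebra ring_quotient.
From mathcomp Require Import generic_quotient wochoice.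
From mathcomp Require Import boolp classical_sets functions cardinality.
From mathcomp Require Import constructive_ereal.

Set Implicit Arguments.
Unset Strict Implicit.
Unset Printing Implicit Defensive.
Import Order.TTheory GRing.Theory Num.Theory.

Local Open Scope classical_set_scope.
Local Open Scope card_scope.
Local Open Scope ring_scope.
Local Open Scope quotient_scope.

(** * Cardinality *)

Definition injects (T U : Type) : Prop := exists f : T -> U, injective f.

Lemma injects_trans (T U V : Type) : injects T U -> injects U V -> injects T V.
Proof. by move=> [f fI] [g gI]; exists (g \o f); apply: inj_comp. Qed.

(** Zorn's lemma on graphs of partial injections: a maximal graph that missed some t and some u
    could be enlarged by the pair (t, u). *)
Lemma injects_total (T U : Type) : injects T U \/ injects U T.
Proof.
pose P (G : set (T * U)) := forall p q, G p -> G q -> (p.1 = q.1 <-> p.2 = q.2).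
have [F FP Ftot p q [X FX Xp] [Y FY Yq]|G [PG Gmax]] := @Zorn_bigcup _ P.
  have [XY|YX] := Ftot _ _ FX FY.
    by apply: (FP Y) => //; apply: XY.
  by apply: (FP X) => //; apply: YX.
have [domG|] := pselect (forall t, exists u, G (t, u)).
  left; have [f fG] := choice domG; exists f => x y fxy.
  exact: (PG _ _ (fG x) (fG y)).2.
move=> /existsNP[t tG].
have [ranG|] := pselect (forall u, exists t, G (t, u)).
  right; have [f fG] := choice ranG; exists f => x y fxy.
  exact: (PG _ _ (fG x) (fG y)).1.
move=> /existsNP[u uG]; exfalso.
apply: (Gmax (G `|` [set (t, u)])).
  by split=> [|/(_ (t, u) (or_intror erefl)) ?]; [exact: subsetUl|apply: tG; exists u].
move=> [t1 u1] [t2 u2] [G1|[-> ->]] [G2|[-> ->]] //=; first exact: (PG _ _ G1 G2).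
- by split=> e; [case: tG; exists u1|case: uG; exists t1]; rewrite -?e.
- by split=> e; [case: tG; exists u2|case: uG; exists t2]; rewrite ?e.
Qed.

(* Zorn's lemma on the graphs of injections [seq A -> A], [A] a subset of [T]
   containing a fixed countable set.  If [A] embeds in its complement, the
   injection extends: elements of the copy of [A] are coded by sequences of
   length 2 over [A]. *)
Lemma injects_seq (T : eqType) : injects nat T -> injects (seq T) T.
Proof.
move=> [e eI].
(* The subset A is not carried along: it is read off from the graph through the one-term
   sequences. *)
pose dom (G : set (seq T * T)) t := exists u, G ([:: t], u).
pose Q (G : set (seq T * T)) := [/\
  forall p q, G p -> G q -> (p.1 = q.1 <-> p.2 = q.2),
  forall s u, G (s, u) -> dom G u /\ {in s, forall t, dom G t},
  forall s, {in s, forall t, dom G t} -> exists u, G (s, u)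
  & exists t, dom G t].
pose G0 : set (seq T * T) :=
  [set p | exists s : seq nat, p = (map e s, e (pickle s))].
have dom0 t : dom G0 t <-> exists n, t = e n.
  split=> [[u [[|n s] []]]//|[n ->]]; first by case: s => // ->; exists n.
  by exists (e (pickle [:: n])), [:: n].
have QG0 : Q G0.
  split.
  - move=> _ _ [s ->] [s' ->] /=; split=> [/(inj_map eI) -> //|/eI].
    by move=> /(pcan_inj pickleK) ->.
  - move=> _ _ [s [-> ->]]; split; first by apply/dom0; eexists.
    by move=> t /mapP[n _ ->]; apply/dom0; exists n.
  - move=> s sG; suff [s' ->] : exists s', s = map e s' by eexists; exists s'.
    elim: s sG => [|t s IHs] sG; first by exists [::].
    have [|s' ->] := IHs; first by move=> t' t's; apply: sG; rewrite inE t's orbT.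
    have /dom0[n ->] : dom G0 t by apply: sG; rewrite inE eqxx.
    by exists (n :: s').
  - by exists (e 0%N); apply/dom0; exists 0%N.
pose P G := G = set0 \/ Q G /\ G0 `<=` G.
have [F FP Ftot|G [PG Gmax]] := @Zorn_bigcup _ P.
  have [F0|/existsNP[X0 /not_implyP[FX0 /eqP X0n]]] :=
    pselect (forall X, F X -> X = set0).
    by left; apply/seteqP; split=> // x [X /F0 ->].
  have QF X : F X -> X !=set0 -> Q X /\ G0 `<=` X.
    by move=> /FP[-> [] //|].
  move: X0n => /set0P X0n; right; split; last first.
    by move=> p /(QF _ FX0 X0n).2 X0p; exists X0.
  have domF X t : F X -> dom X t -> dom (\bigcup_(X in F) X) t.
    by move=> FX [u Xu]; exists u, X.
  have domFE t : dom (\bigcup_(X in F) X) t -> exists2 X, F X & dom X t.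
    by move=> [u [X FX Xu]]; exists X => //; exists u.
  split.
  - move=> p q [X FX Xp] [Y FY Yq].
    have [XY|YX] := Ftot _ _ FX FY.
      by have [[+ _ _ _] _] := QF _ FY (ex_intro _ _ Yq); apply=> //; apply: XY.
    by have [[+ _ _ _] _] := QF _ FX (ex_intro _ _ Xp); apply=> //; apply: YX.
  - move=> s u [X FX Xsu].
    have [[_ /(_ _ _ Xsu)[Xu Xs] _ _] _] := QF _ FX (ex_intro _ _ Xsu).
    by split=> [|t /Xs Xt]; apply: (domF X).
  - move=> s sF.
    (* A finite sequence over the union of the chain already lies over one of its members. *)
    suff [X [FX Xn sX]] : exists X, [/\ F X, X !=set0 & {in s, forall t, dom X t}].
      have [[_ _ /(_ _ sX)[u Xu] _] _] := QF _ FX Xn.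
      by exists u, X.
    elim: s sF => [|t s IHs] sF; first by exists X0.
    have [|X [FX Xn sX]] := IHs.
      by move=> t' t's; apply: sF; rewrite inE t's orbT.
    have [|Y FY tY] := domFE t; first by apply: sF; rewrite inE eqxx.
    have [XY|YX] := Ftot _ _ FX FY.
      exists Y; split=> //; first by have [p Xp] := Xn; exists p; apply: XY.
      by move=> t'; rewrite inE => /predU1P[-> //|/sX[u Xu]]; exists u; apply: XY.
    exists X; split=> // t'; rewrite inE => /predU1P[-> //|/sX//].
    by have [u Yu] := tY; exists u; apply: YX.
  - have [[_ _ _ [t X0t]] _] := QF _ FX0 X0n.
    by exists t; apply: (domF X0).
have [QG G0G] : Q G /\ G0 `<=` G.
  case: PG => // G0'; exfalso; apply: (Gmax G0); last by right; split.
  rewrite G0'; split=> [|/(_ ([::], e (pickle ([::] : seq nat))))]; first exact: sub0set.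
  by apply; exists [::].
case: QG => Gfun Gsub Gtot [t0 Gt0].
pose A := {t | `[< dom G t >]}.
have AP (a : A) : dom G (val a) by case: a => a /= /asboolP.
have [f fP] : exists f : seq A -> A, forall s, G (map val s, val (f s)).
  suff /choice[f fP] : forall s : seq A, exists a : A, G (map val s, val a) by exists f.
  move=> s; have [|u Gu] := Gtot (map val s); first by move=> _ /mapP[a _ ->].
  by have [/asboolP Au _] := Gsub _ _ Gu; exists (Sub u Au).
have fI : injective f.
  move=> s s' /(congr1 val) ff; have := (Gfun _ _ (fP s) (fP s')).2 ff.
  exact/(inj_map val_inj).
(* [f] is used twice: on the image of each entry, then on the resulting sequence over [A]. *)
have seq2 (V : Type) : injects V (seq A) -> injects (seq V) A.
  move=> [c cI]; exists (fun s => f (map (f \o c) s)).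
  by move=> s s' /fI; apply/inj_map/inj_comp.
have [[h hI]|[h hI]] := injects_total {t | ~~ `[< dom G t >]} A.
  have /seq2 sTA : injects T (seq A).
    have /choice[c cP] : forall t : T, exists s : seq A,
        (exists a, t = val a /\ s = [:: a]) \/
        (exists b, t = val b /\ s = [:: h b; h b]).
      move=> t; have [Gt|Gt] := boolP `[< dom G t >].
        by exists [:: Sub t Gt]; left; exists (Sub t Gt).
      by exists [:: h (Sub t Gt); h (Sub t Gt)]; right; exists (Sub t Gt).
    exists c => x y cxy.
    case: (cP x) (cP y) => [[a [xE cx]]|[a [xE cx]]] [[b [yE cy]]|[b [yE cy]]];
      move: cxy; rewrite {}cx {}cy => cxy; have /= := congr1 size cxy => // _;
      case: cxy => ab; rewrite xE yE; first [by rewrite ab|by rewrite (hI _ _ ab)].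
  by apply: injects_trans sTA _; exists val; apply: val_inj.
exfalso.
pose D' t := dom G t \/ exists a, t = val (h a).
pose D := {t | `[< D' t >]}.
have /seq2[g gI] : injects D (seq A).
  have /choice[c cP] : forall d : D, exists s : seq A,
      (exists a : A, val d = val a /\ s = [:: a]) \/
      (exists a : A, val d = val (h a) /\ s = [:: a; a]).
    move=> [d /= /asboolP[/asboolP dG|[a ->]]].
      by exists [:: Sub d dG]; left; exists (Sub d dG).
    by exists [:: a; a]; right; exists a.
  exists c => x y cxy; apply: val_inj.
  case: (cP x) (cP y) => [[a [xE cx]]|[a [xE cx]]] [[b [yE cy]]|[b [yE cy]]];
    move: cxy; rewrite {}cx {}cy => cxy; have /= := congr1 size cxy => // _;
    case: cxy => ab; by rewrite xE yE ab.
(* The new sequences, those not over A alone, take values in the copy of A, which is disjoint from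
   all old values. *)
pose G1 : set (seq T * T) := [set p | exists s : seq D,
   [/\ p.1 = map val s, ~ {in p.1, forall t, dom G t} & p.2 = val (h (g s))]].
have hNG a : ~ dom G (val (h a)) by move=> /asboolP; apply/negP; exact: valP (h a).
have DG1 t : D' t -> dom (G `|` G1) t.
  move=> Dt; have [[u Gu]|NGt] := pselect (dom G t); first by exists u; left.
  move: Dt => /asboolP Dt; exists (val (h (g [:: Sub t Dt : D]))); right.
  exists [:: Sub t Dt : D]; split=> //.
  by move=> /(_ t); rewrite inE eqxx => /(_ isT).
have G1D t : dom (G `|` G1) t -> D' t.
  move=> [u [Gu|[s [/= ts _ _]]]]; first by left; exists u.
  by case: s ts => // d [|//] [->]; case: d => d /= /asboolP.
have [a0 a0t] : exists a : A, val a = t0.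
  by move: Gt0 => /asboolP Gt0; exists (Sub t0 Gt0).
have D'G s : {in s, forall t, D' t} -> exists s' : seq D, s = map val s'.
  elim: s => [|t s IHs] sD; first by exists [::].
  have [|s' ->] := IHs; first by move=> t' t's; apply: sD; rewrite inE t's orbT.
  have /asboolP tD : D' t by apply: sD; rewrite inE eqxx.
  by exists ((Sub t tD : D) :: s').
apply: (Gmax (G `|` G1)).
  split=> [|GG]; first exact: subsetUl.
  have /DG1[u /GG Gu] : D' (val (h a0)) by right; exists a0.
  by apply: (hNG a0); exists u.
right; split; last by move=> p /G0G; left.
split.
- move=> [s u] [s' u'] [Gp|[/= d [sd ds ud]]] [Gq|[/= d' [sd' ds' ud']]].
  + exact: Gfun.
  + split=> /= [ss|uu]; first by case: ds'; rewrite -ss; exact: (Gsub _ _ Gp).2.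
    by have [/[dup] + _] := Gsub _ _ Gp; rewrite uu ud' => /hNG.
  + split=> /= [ss|uu]; first by case: ds; rewrite ss; exact: (Gsub _ _ Gq).2.
    by have [/[dup] + _] := Gsub _ _ Gq; rewrite -uu ud => /hNG.
  + rewrite /= sd sd' ud ud'; split=> [/(inj_map val_inj) -> //|].
    by move=> /val_inj/hI/gI ->.
- move=> s u [Gsu|[d [/= -> _ ->]]].
    have [Gu Gs] := Gsub _ _ Gsu.
    by split=> [|t /Gs]; [have [v ?] := Gu; exists v; left|move=> [v ?]; exists v; left].
  split; first by apply: DG1; right; eexists.
  by move=> _ /mapP[[x /= /asboolP Dx] _ ->]; apply: DG1.
- move=> s sG.
  have [sG'|sG'] := pselect {in s, forall t, dom G t}.
    by have [u Gu] := Gtot _ sG'; exists u; left.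
  have [s' ss'] : exists s' : seq D, s = map val s' by apply: D'G => t /sG/G1D.
  by exists (val (h (g s'))); right; exists s'.
- by have [u Gu] := Gt0; exists t0, u; left.
Qed.

Lemma injects_prod_seq (T U : Type) (Z : eqType) : injects nat Z ->
  injects T Z -> injects U Z -> injects (T * U) Z.
Proof.
move=> natZ [f fI] [g gI]; apply: injects_trans (injects_seq natZ).
exists (fun p => [:: f p.1; g p.2]) => -[t u] [t' u'] /= e.
by case: e => /fI -> /gI ->.
Qed.

Lemma injects_seq_seq (T : Type) (Z : eqType) : injects nat Z ->
  injects T Z -> injects (seq T) Z.
Proof.
move=> natZ [f fI]; apply: injects_trans (injects_seq natZ).
by exists (map f); apply: inj_map.
Qed.

(** The long type codes a polynomial over a ring generated by [X], the index of a prime, and a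
    position in a list. It injects into the larger of [X] and [nat]. *)
Lemma not_injects_code (K : Type) (X : eqType) :
  ~ injects K nat -> ~ injects K X ->
  ~ injects K (seq (seq (bool * seq X)) * nat * nat).
Proof.
move=> KN KX Kcode.
suff code (Z : eqType) : injects nat Z -> injects X Z -> injects K Z.
  have natxx : injects nat nat by exists id.
  have XX : injects X X by exists id.
  by have [XN|NX] := injects_total X nat; [apply: KN|apply: KX]; apply: code.
move=> NZ XZ; apply: injects_trans Kcode _.
apply: injects_prod_seq => //; apply: injects_prod_seq => //.
do 2!apply: injects_seq_seq => //; apply: injects_prod_seq => //; last first.
  exact: injects_seq_seq.
by apply: injects_trans NZ; exists nat_of_bool => -[] [].
Qed.

(** [W] has order type the cardinal of [T]: it consists of the elements with a small initial
    segment. If it is not all of [T], the segment below the least element outside [W] lies in [W],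
    and [T] injects into that segment. *)
Lemma small_well_order (T : eqType) :
  exists (lt : T -> T -> Prop) (W : set T),
  [/\ well_founded lt,
      (forall x y z, lt x y -> lt y z -> lt x z),
      (forall x y, [\/ lt x y, x = y | lt y x]),
      forall w, W w -> ~ injects T [set v | lt v w] /\ [set v | lt v w] `<=` W
    & injects T W].
Proof.
have [R Rwo] := well_ordering_principle T.
have /withinW Rwc := Rwo; have {Rwc} Rwc : wo_chain R predT by apply: Rwc.
have Rtot x y : R x y || R y x by apply: (wo_chainW Rwc).
have Ranti x y : R x y -> R y x -> x = y.
  by move=> xy yx; apply: (wo_chain_antisymmetric Rwc) => //; rewrite xy yx.
have Rmin (A : set T) : A !=set0 -> exists2 z, A z & forall x, A x -> R z x.
  move=> [a Aa]; have [|z [[/asboolP Az zmin] _]] := Rwo (fun x => `[< A x >]).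
    by exists a; apply/asboolP.
  by exists z => // x Ax; apply: zmin; apply/asboolP.
pose lt x y := R x y /\ x <> y.
have lt_total x y : [\/ lt x y, x = y | lt y x].
  have [->|/eqP xy] := eqVneq x y; first by constructor 2.
  have /orP[Rxy|Ryx] := Rtot x y; [constructor 1|constructor 3]; split=> //.
  by move/esym.
have lt_irr x y : R x y -> ~ lt y x.
  by move=> Rxy [Ryx /(_ (Ranti _ _ Ryx Rxy))].
have lt_trans x y z : lt x y -> lt y z -> lt x z.
  move=> xy yz; have [u] := Rmin [set x; y; z] (ex_intro _ x (or_introl (or_introl erefl))).
  move=> [[->|->]|->] umin.
  - have Rxz : R x z by apply: umin; right.
    by split=> // xz; apply: (lt_irr y z yz.1); rewrite -xz.
  - by case: (lt_irr y x) => //; apply: umin; left; left.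
  - by case: (lt_irr z y) => //; apply: umin; left; right.
have lt_wf : well_founded lt.
  move=> a; apply: contrapT => /(ex_intro (fun x => ~ Acc lt x) a).
  move=> /Rmin[z zA zmin]; apply: zA; constructor=> y yz.
  by apply: contrapT => /zmin /lt_irr.
exists lt; pose W := [set w | ~ injects T [set v | lt v w]]; exists W.
have mono (A A' : set T) : A `<=` A' -> injects T A -> injects T A'.
  move=> AA' [f fI]; exists (fun t => SigSub (mem_set (AA' _ (set_mem (valP (f t)))))).
  by move=> x y /(congr1 val)/= /val_inj/fI.
have Wdown w v : W w -> lt v w -> W v.
  by move=> Ww vw /(mono _ [set u | lt u w]) h; apply/Ww/h => u uv; apply: lt_trans uv vw.
split=> // [w Ww|]; first by split=> // v /(Wdown _ _ Ww).
have [TW|/existsNP NW] := pselect (forall w, W w).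
  by exists (fun t => SigSub (mem_set (TW t))) => x y /(congr1 val).
have [w0 w0W w0min] := Rmin [set w | ~ W w] NW.
move: w0W => /contrapT; apply: mono => v vw0.
by apply: contrapT => /w0min /lt_irr.
Qed.

(** * Generic subrings *)

(* Codes the ring expression \sum_i +- \prod_j g x_ij as a sequence, so that
   the subring generated by g is the image of a set whose size is controlled. *)
Definition eval_code (R : comNzRingType) (X : Type) (g : X -> R)
    (l : seq (bool * seq X)) : R :=
  \sum_(t <- l) (-1) ^+ t.1 * \prod_(x <- t.2) g x.

Definition gen_ring (R : comNzRingType) (X : Type) (g : X -> R) : {pred R} :=
  fun z => `[< exists l, z = eval_code g l >].

Lemma gen_ring_closed (R : comNzRingType) (X : Type) (g : X -> R) :
  subring_closed (gen_ring g).
Proof.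
split.
- apply/asboolP; exists [:: (false, [::])].
  by rewrite /eval_code big_seq1 big_nil mulr1.
- move=> _ _ /asboolP[l ->] /asboolP[l' ->]; apply/asboolP.
  exists (l ++ [seq (~~ t.1, t.2) | t <- l']); rewrite /eval_code big_cat big_map /=.
  by congr (_ + _); rewrite -sumrN; apply: eq_bigr => t _; rewrite signrN mulNr.
- move=> _ _ /asboolP[l ->] /asboolP[l' ->]; apply/asboolP.
  exists [seq (t.1 (+) t'.1, t.2 ++ t'.2) | t <- l, t' <- l'].
  rewrite /eval_code big_allpairs_dep mulr_suml; apply: eq_bigr => t _.
  rewrite mulr_sumr; apply: eq_bigr => t' _.
  by rewrite big_cat /= signr_addb mulrACA.
Qed.

HB.instance Definition _ (R : comNzRingType) (X : Type) (g : X -> R) :=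
  GRing.isSubringClosed.Build R (gen_ring g) (gen_ring_closed g).

Lemma gen_ring_gen (R : comNzRingType) (X : Type) (g : X -> R) x :
  g x \in gen_ring g.
Proof.
apply/asboolP; exists [:: (false, [:: x])].
by rewrite /eval_code big_seq1 big_seq1 mul1r.
Qed.

Lemma idealr_closedP (R : comNzRingType) (I : {pred R}) :
  idealr_closed I -> exists J : idealr R, I = J.
Proof.
move=> cI; pose h := isIdealr.Build R I cI.
by exists (HB.pack_for (idealr R) I h).
Qed.

Lemma prime_idealP (R : comNzRingType) (I : {pred R}) :
  prime_ideal I -> exists J : prime_idealr R, I = J.
Proof.
move=> [cI pI]; pose h := isIdealr.Build R I cI.
pose h' := isPrimeIdealrClosed.Build R I pI.
by exists (HB.pack_for (prime_idealr R) I h h').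
Qed.

(** Division by X - u takes place over R: if p = q (X - u) + p(u) with p(u) in Q, any other root v
    of p modulo Q is a root of q modulo Q, as v - u is not in Q. *)
Lemma roots_mod_prime (R : comNzRingType) (Q : prime_idealr R) (us : seq R)
    (p : {poly R}) :
  (exists i, p`_i \notin Q) -> pairwise (fun u v => u - v \notin Q) us ->
  {in us, forall u, p.[u] \in Q} -> (size us < size p)%N.
Proof.
elim: us p => [|u us IHus] p [i pi] /=.
  move=> _ _; rewrite lt0n size_poly_eq0; apply: contraNneq pi => ->.
  by rewrite coef0 rpred0.
move=> /andP[/allP uus pw] pQ.
have /factor_theorem[q pq] : root (p - p.[u]%:P) u.
  by rewrite /root !hornerE subrr.
have {}pq : p = q * ('X - u%:P) + p.[u]%:P by rewrite -pq subrK.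
have puQ : p.[u] \in Q by apply: pQ; rewrite inE eqxx.
have [j qj] : exists j, q`_j \notin Q.
  apply: contrapT => /forallNP qQ; move/negP: pi; apply.
  have {}qQ j : q`_j \in Q by apply: contrapT => /negP; apply: qQ.
  rewrite pq coefD coefC mulrBr coefB coefMX coefMC rpredD //.
    by rewrite rpredB //; [case: ifP => // _; apply: rpred0|rewrite mulrC idealMr].
  by case: ifP => // _; apply: rpred0.
have q0 : q != 0 by apply: contraNneq qj => ->; rewrite coef0 rpred0.
have -> : size p = (size q).+1.
  rewrite pq size_polyDl size_Mmonic ?monicXsubC ?size_XsubC ?addn2 //=.
  by rewrite (leq_ltn_trans (size_polyC_leq1 _)) // ltnS lt0n size_poly_eq0.
rewrite ltnS; apply: IHus pw _; first by exists j.
move=> v vus; have : p.[v] \in Q by apply: pQ; rewrite inE vus orbT.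
move=> /rpredB/(_ puQ); rewrite {1}pq !hornerE addrK prime_idealrM.
by move=> /orP[//|uvQ]; have := uus _ vus; rewrite -opprB rpredN uvQ.
Qed.

Section Transcendental.
Context (R : comNzRingType) (n : nat) (Q : 'I_n -> prime_idealr R).

(** When [gen_ring g] meets every Q_i in 0 only, this is transcendence over [gen_ring g] of the
    image of x in each R/Q_i. *)
Definition transcendental_mod (X : Type) (g : X -> R) (x : R) : Prop :=
  forall p, p \is a polyOver (gen_ring g) -> p != 0 -> forall i, p.[x] \notin Q i.

(** Otherwise every class of R/M is bad for some polynomial and some prime. Such a pair has finitely
    many bad classes, so a class is determined by the code of the polynomial, the index of the prime
    and a position in a finite list; R/M would inject into the code type. *)
Lemma transcendental_shift (M : idealr R) (X : eqType) (g : X -> R) (a b : R) :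
  (forall i, {subset Q i <= M}) ->
  ~ injects {ideal_quot M} nat -> ~ injects {ideal_quot M} X ->
  (forall i z, z \in gen_ring g -> z \in Q i -> z = 0) ->
  (forall i, a \notin Q i) ->
  exists y, transcendental_mod g (b + a * y).
Proof.
move=> QM KN KX gQ aQ; pose K := {ideal_quot M}; rewrite -/K in KN KX.
apply: contrapT => /forallNP bad; apply: (not_injects_code KN KX).
pose P (l : seq (seq (bool * seq X))) : {poly R} := Poly (map (eval_code g) l).
pose badset l j : set K := [set u | exists i : 'I_n,
  [/\ val i = j, P l != 0, P l \is a polyOver (gen_ring g)
    & (P l).[b + a * repr u] \in Q i]].
have badP u : exists lj, badset lj.1 lj.2 u.
  have /existsNP[p /not_implyP[pO /not_implyP[p0 /existsNP[i /negP]]]] := bad (repr u).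
  rewrite negbK => pi.
  have /choice[c cP] : forall k, exists l, p`_k = eval_code g l.
    by move=> k; apply/asboolP; move/polyOverP: pO; apply.
  have Pp : P (mkseq c (size p)) = p.
    apply/polyP => k; rewrite coef_Poly.
    have [kp|pk] := ltnP k (size p).
      by rewrite (nth_map [::]) ?size_mkseq // nth_mkseq // cP.
    by rewrite [RHS]nth_default // nth_default // size_map size_mkseq.
  by exists (mkseq c (size p), val i), i; rewrite Pp.
(* An infinite set of bad classes would give more roots modulo Q_i than the size of the polynomial
   allows. *)
have badfin l j : exists s : seq K, forall u, badset l j u -> u \in s.
  apply: contrapT => /forallNP nos.
  have step k : exists s : seq K,
      [/\ size s = k, uniq s & {in s, forall u, badset l j u}].
    elim: k => [|k [s [sk su sb]]]; first by exists [::].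
    have /existsNP[u /not_implyP[ub /negP us]] := nos s.
    exists (u :: s); split=> /=; first by rewrite sk.
      by rewrite us.
    by move=> v; rewrite inE => /predU1P[->|/sb].
  have [s [ss su sb]] := step (size (P l)).+1.
  have [u0 /sb[i [ij Pl0 PlO _]]] : exists u, u \in s.
    by case: s ss {su sb} => // u s _; exists u; rewrite inE eqxx.
  suff : (size [seq (b + a * repr u)%R | u <- s] < size (P l))%N.
    by rewrite size_map ss ltnNge leqnSn.
  apply: (@roots_mod_prime _ (Q i)).
  - apply: contrapT => /forallNP PQ; move/eqP: Pl0; apply; apply/polyP => k.
    rewrite coef0; apply: (gQ i); first exact/polyOverP.
    by apply: contrapT => /negP; apply: PQ.
  (* Distinct classes have representatives incongruent modulo M, hence modulo the smaller Q_i, and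
     multiplication by [a] outside Q_i preserves this. *)
  - rewrite pairwise_map; have := su; rewrite uniq_pairwise.
    apply: sub_pairwise => u v /= uv; rewrite opprD addrACA subrr add0r -mulrBr.
    rewrite prime_idealrM negb_or aQ /=; apply: contra uv => /QM.
    by rewrite Quotient.idealrBE !reprK.
  - move=> _ /mapP[u /sb[i' [i'j _ _ Pu]] ->].
    by rewrite (_ : i = i') //; apply: val_inj; rewrite ij i'j.
have [c cP] := choice badP.
have /choice[s sP] : forall lj, exists s : seq K, forall u, badset lj.1 lj.2 u -> u \in s.
  by move=> lj; apply: badfin.
exists (fun u => ((c u).1, (c u).2, index u (s (c u)))) => u v [c1 c2].
have cE : c u = c v by rewrite [LHS]surjective_pairing c1 c2 -surjective_pairing.
rewrite cE => uv.
have us : u \in s (c v) by rewrite -cE; apply: sP.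
by rewrite -(nth_index u us) uv nth_index //; apply: sP.
Qed.

(** Only finitely many terms occur in z. If x_w is the last one, then z = p(x_w) with p over the
    ring generated by earlier terms: either p = 0 and z = 0, or transcendence keeps z out of Q_i. *)
Lemma gen_ring_cap_prime (T : eqType) (lt : T -> T -> Prop) (x : T -> R) (D : set T) :
  (forall x y z, lt x y -> lt y z -> lt x z) ->
  (forall x y, [\/ lt x y, x = y | lt y x]) ->
  (forall i (k : int), (k%:~R : R) \in Q i -> (k%:~R : R) = 0) ->
  (forall w, D w ->
     transcendental_mod (fun v : [set v | lt v w] => x (val v)) (x w)) ->
  forall i z, z \in gen_ring (fun v : D => x (val v)) -> z \in Q i -> z = 0.
Proof.
move=> lt_trans lt_total intQ Dtr i z /asboolP[l ->{z}].
pose idx := [seq val v | v : D <- flatten [seq t.2 | t <- l]].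
have idxP t v : t \in l -> v \in t.2 -> val v \in idx.
  by move=> tl vt; apply/map_f/flattenP; exists t.2 => //; apply: map_f.
have idxD v : v \in idx -> D v.
  by move=> /mapP[w _ ->]; exact: set_mem (valP w).
have [idx0|[w widx wmax]] : idx = [::] \/
    exists2 w, w \in idx & {in idx, forall v, v <> w -> lt v w}.
  elim: (idx) => [|v s [->|[w ws wmax]]]; first by left.
    by right; exists v; rewrite ?inE // => u; rewrite inE => /eqP.
  right; have [vw|->|wv] := lt_total v w.
  - exists w; first by rewrite inE ws orbT.
    by move=> u; rewrite inE => /predU1P[-> //|/wmax].
  - exists w; first by rewrite inE eqxx.
    by move=> u; rewrite inE => /predU1P[//|/wmax].
  - exists v; first by rewrite inE eqxx.
    move=> u; rewrite inE => /predU1P[//|us _].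
    by have [->//|/eqP/(wmax _ us)/lt_trans] := eqVneq u w; apply.
(* With no term occurring, z is a sum of signs, hence an integer. *)
- suff [k ->] : exists k : int, eval_code (fun v : D => x (val v)) l = k%:~R by apply: intQ.
  exists (\sum_(t <- l) (-1) ^+ t.1); rewrite /eval_code rmorph_sum /= big_seq.
  rewrite [RHS]big_seq; apply: eq_bigr => t tl; rewrite rmorphXn rmorphN1.
  case t2: t.2 => [|v s]; first by rewrite big_nil mulr1.
  by have := idxP t v tl; rewrite t2 idx0 inE eqxx => /(_ isT).
(* The polynomial p is z with its last term replaced by the variable. *)
pose y (v : D) : {poly R} := if pselect (val v = w) then 'X else (x (val v))%:P.
pose p : {poly R} := eval_code y l.
have px : p.[x w] = eval_code (fun v : D => x (val v)) l.
  rewrite /p /eval_code horner_sum; apply: eq_bigr => t _.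
  rewrite hornerM -[(-1) ^+ t.1]/((-1) ^+ t.1) horner_prod.
  congr (_ * _).
    by case: (t.1); rewrite ?expr0 ?expr1 !hornerE.
  apply: eq_bigr => v _; rewrite /y; by case: pselect => /= [vw|_]; rewrite ?vw !hornerE.
have pO : p \is a polyOver (gen_ring (fun v : [set v | lt v w] => x (val v))).
  rewrite /p /eval_code big_seq; apply: rpred_sum => t tl; apply: rpredM.
    exact: rpred_sign.
  rewrite big_seq; apply: rpred_prod => v vt; rewrite /y.
  case: pselect => /= [_|vw]; first exact: polyOverX.
  have lvw : lt (val v) w by apply: wmax => //; apply: idxP vt.
  rewrite polyOverC.
  exact: (gen_ring_gen (fun v : [set v | lt v w] => x (val v)) (SigSub (mem_set lvw))).
have [p0|p0] := eqVneq p 0; first by rewrite -px p0 horner0.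
by rewrite -px (negPf (Dtr w (idxD _ widx) p pO p0 i)).
Qed.

Lemma generic_subring (M : idealr R) (c : R) :
  (forall i, {subset Q i <= M}) ->
  ~ injects {ideal_quot M} nat -> injects R {ideal_quot M} ->
  (forall i (k : int), (k%:~R : R) \in Q i -> (k%:~R : R) = 0) ->
  c \in M -> (forall i, c \notin Q i) ->
  exists S : subringClosed R, (forall i z, z \in S -> z \in Q i -> z = 0) /\
    forall a b, (forall i, a \notin Q i) -> exists2 y, y \in M & b + a * y \in S.
Proof.
move=> QM KN RK intQ cM cQ.
have [lt [W [lt_wf lt_trans lt_total Wsmall RW]]] := small_well_order R.
have NR : injects nat R.
  have [//|RN] := injects_total nat R; case: KN; apply: injects_trans RN.
  by exists repr => u v /(congr1 \pi_{ideal_quot M}); rewrite !reprK.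
(* [j] places the pairs (b, a) along [W]; [h] below inverts it, with (0, 0) at the places left
   free. *)
have [j jI] : injects (R * R) W.
  by apply: injects_trans RW; apply: injects_prod_seq => //; exists id.
have /choice[h hP] : forall w, exists p : R * R,
    forall q, w = val (j q) -> q = p.
  move=> w; have [[q ->]|nq] := pselect (exists q, w = val (j q)).
    by exists q => q' /val_inj/jI.
  by exists (0, 0) => q wq; case: nq; exists q.
(* A second entry that is not regular is replaced by 1, so that a transcendental term exists at
   every place of [W]. *)
pose a w := if pselect (forall i, (h w).2 \notin Q i) then (h w).2 else 1.
have aQ w i : a w \notin Q i by rewrite /a; case: pselect => /= // _; rewrite idealr1.
(* For w in [W] the default 0 is never taken, as the induction in [xP] shows. *)
pose G w (g : [set v | lt v w] -> R) : R := xget 0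
  [set x | (exists y, x = (h w).1 + (a w * c) * y) /\ transcendental_mod g x].
pose x : R -> R := Fix lt_wf (fun _ => R)
  (fun w rec => G w (fun v => rec (val v) (set_mem (valP v)))).
have xE w : x w = G w (fun v => x (val v)).
  rewrite /x Fix_eq // => w' f g fg; congr G; apply: funext => v; exact: fg.
have xP w : W w -> (exists y, x w = (h w).1 + (a w * c) * y) /\
    transcendental_mod (fun v : [set v | lt v w] => x (val v)) (x w).
  elim/(well_founded_ind lt_wf): w => w IHw Ww.
  rewrite (xE w) /G; case: xgetP => [z -> //|noz].
  have [wsmall wW] := Wsmall w Ww.
  have [|||||y tr] := @transcendental_shift M _
      (fun v : [set v | lt v w] => x (val v)) (a w * c) (h w).1 => //.
  (* An injection of R/M into the earlier terms would give one of R, against the smallness of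
     initial segments of [W]. *)
  - by move=> Kw; apply: wsmall; apply: injects_trans RK Kw.
  - apply: gen_ring_cap_prime lt_trans lt_total intQ _ => v vw.
    exact: (IHw v vw (wW _ vw)).2.
  - by move=> i; rewrite prime_idealrM negb_or aQ cQ.
  - by case: (noz ((h w).1 + a w * c * y)); split=> //; exists y.
exists (gen_ring (fun v : W => x (val v)) : subringClosed R); split.
  by apply: gen_ring_cap_prime lt_trans lt_total intQ _ => w /xP[].
move=> a0 b a0Q; pose w := j (b, a0); have [|[y xw] _] := xP (val w).
  exact: set_mem (valP w).
(* The factor c is what puts the correction in M. *)
exists (c * y); first by rewrite mulrC idealMr.
have hw : h (val w) = (b, a0) by rewrite -(hP _ (b, a0)).
have := gen_ring_gen (fun v : W => x (val v)) w.
by rewrite xw /a hw /=; case: pselect => //= _; rewrite mulrA.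
Qed.

End Transcendental.

(** * Noetherian rings and minimal primes *)

Section IdealGen.
Context (R : comNzRingType).
Implicit Types (A : set R) (I J : {pred R}).

Lemma ideal_gen_gen A x : A x -> x \in ideal_gen A.
Proof.
move=> Ax; apply/ideal_genP; exists 1%N, (fun _ => 1), (fun _ => x).
by split=> //; rewrite big_ord1 mul1r.
Qed.

Lemma ideal_gen0 A : 0 \in ideal_gen A.
Proof.
apply/ideal_genP; exists 0%N, (fun _ => 0), (fun _ => 0).
by split=> [[]|] //; rewrite big_ord0.
Qed.

Lemma ideal_gen_sum A (T : Type) (s : seq T) (a y : T -> R) :
  (forall t, y t \in ideal_gen A) -> \sum_(t <- s) a t * y t \in ideal_gen A.
Proof.
move=> yA; elim: s => [|t s IHs]; first by rewrite big_nil ideal_gen0.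
by rewrite big_cons ideal_genD.
Qed.

Lemma ideal_gen_le A A' :
  (forall x, A x -> x \in ideal_gen A') -> {subset ideal_gen A <= ideal_gen A'}.
Proof.
by move=> AA' x /ideal_genP[k [a [y [Ay ->]]]]; apply: ideal_gen_sum => i; apply: AA'.
Qed.

Lemma ideal_gen_sub A I :
  idealr_closed I -> A `<=` [set` I] -> {subset ideal_gen A <= I}.
Proof.
move=> /idealr_closedP[J ->] AJ x /ideal_genP[k [a [y [Ay ->]]]].
by apply: rpred_sum => i _; apply: idealMr; apply: AJ.
Qed.

Lemma ideal_gen_closed A : 1 \notin ideal_gen A -> idealr_closed (ideal_gen A).
Proof. by move=> A1; split=> //; [apply: ideal_gen0|move=> a u v; apply: ideal_genD]. Qed.

(** Each of finitely many generators is a combination of finitely many elements of [A], and these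
    are collected. The ideal [I] makes the ideal generated by [A] proper, the only kind that
    [noetherian] covers. *)
Lemma noetherian_fg A I : noetherian R -> idealr_closed I -> A `<=` [set` I] ->
  exists2 s : seq R, (forall x, x \in s -> A x) & {subset ideal_gen A <= ideal_gen [set` s]}.
Proof.
move=> nR cI AI; have [|s sA] := nR (ideal_gen A).
  apply: ideal_gen_closed; apply/negP => /(ideal_gen_sub cI AI).
  by apply/negP; case: cI.
have [s' s'A ss'] : exists2 s' : seq R, (forall x, x \in s' -> A x) &
    {in s, forall x, x \in ideal_gen [set` s']}.
  have {sA} : {in s, forall x, x \in ideal_gen A}.
    by move=> x xs; rewrite sA; apply: ideal_gen_gen.
  elim: s => [|x s IHs] sA; first by exists [::].
  have [|s' s'A ss'] := IHs; first by move=> y ys; apply: sA; rewrite inE ys orbT.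
  have /ideal_genP[k [a [y [Ay xE]]]] : x \in ideal_gen A by apply: sA; rewrite inE eqxx.
  exists ([seq y i | i <- enum 'I_k] ++ s').
    by move=> z; rewrite mem_cat => /orP[/mapP[i _ ->]|/s'A].
  move=> z; rewrite inE => /predU1P[->|/ss'].
    rewrite xE; apply: ideal_gen_sum => i; apply: ideal_gen_gen => /=.
    by rewrite mem_cat map_f // mem_enum.
  by apply: ideal_gen_le => t ts; apply: ideal_gen_gen; rewrite /= mem_cat ts orbT.
by exists s' => // x; rewrite sA; apply: ideal_gen_le => y /ss'.
Qed.

(** A counterexample would start a strictly increasing chain of proper ideals; its union is proper
    and finitely generated, so the chain stops. *)
Lemma noetherian_ind (P : {pred R} -> Prop) : noetherian R ->
  (forall I, idealr_closed I ->
    (forall J, idealr_closed J -> {subset I <= J} -> ~ {subset J <= I} -> P J) ->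
    P I) ->
  forall I, idealr_closed I -> P I.
Proof.
move=> nR Pind I0 cI0; apply: contrapT => PI0.
pose bad := {I : {pred R} | idealr_closed I /\ ~ P I}.
have /choice[next nextP] : forall I : bad, exists J : bad,
    {subset sval I <= sval J} /\ ~ {subset sval J <= sval I}.
  move=> [I [cI PI]]; apply: contrapT => noJ; apply/PI/Pind => // J cJ IJ JI.
  by apply: contrapT => PJ; apply: noJ; exists (exist _ J (conj cJ PJ)).
pose c k : {pred R} := sval (iter k next (exist _ I0 (conj cI0 PI0))).
have cle i j : (i <= j)%N -> {subset c i <= c j}.
  move=> /subnK <-; elim: (j - i)%N => [//|k IHk] x /IHk.
  by have [+ _] := nextP (iter (k + i) next (exist _ I0 (conj cI0 PI0))); apply.
have cc k : idealr_closed (c k) by rewrite /c; case: (iter _ _ _) => I [].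
pose U : {pred R} := fun x => `[< exists k, x \in c k >].
have [|s sU] := nR U.
  split; first by apply/asboolP; exists 0%N; case: (cc 0%N).
    by apply/asboolP => -[k]; apply/negP; case: (cc k).
  move=> a u v /asboolP[i ui] /asboolP[j vj]; apply/asboolP; exists (maxn i j).
  have [_ _ h] := cc (maxn i j).
  by apply: h; [apply: (cle i)|apply: (cle j)]; rewrite ?leq_maxl ?leq_maxr.
have [k sk] : exists k, {in s, forall x, x \in c k}.
  have : {in s, forall x, x \in U} by move=> x xs; rewrite sU; apply: ideal_gen_gen.
  elim: s {sU} => [|x s IHs] sU; first by exists 0%N.
  have [|i si] := IHs; first by move=> y ys; apply: sU; rewrite inE ys orbT.
  have /asboolP[j xj] : x \in U by apply: sU; rewrite inE eqxx.
  exists (maxn i j) => y; rewrite inE => /predU1P[->|/si].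
    exact: (cle j _ (leq_maxr _ _)).
  exact: (cle i _ (leq_maxl _ _)).
have [_] := nextP (iter k next (exist _ I0 (conj cI0 PI0))); apply=> x xk.
have : x \in U by apply/asboolP; exists k.+1.
by rewrite sU; apply: ideal_gen_sub; [apply: cc|move=> y; apply: sk].
Qed.

(** Noetherian induction first puts every proper ideal inside M; the ideal generated by x is
    therefore not proper. *)
Lemma local_unit (M : {pred R}) x : local_ring M -> x \notin M ->
  exists y, x * y = 1.
Proof.
move=> [[maxM uniqM] nR] xM.
have sub I : idealr_closed I -> {subset I <= M}.
  move: I; apply: noetherian_ind => // I cI IH.
  have [maxI|] := pselect (maximal_ideal I); first by move=> y; rewrite (uniqM _ maxI).
  move=> /not_andP[//|/existsNP[J /not_implyP[cJ /not_implyP[IJ JI]]]] y yI.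
  apply: (IH J) => //; last exact: IJ.
  by move=> JI'; apply: JI => z; apply/idP/idP => [/JI'|/IJ].
apply: contrapT => nox; move/negP: xM; apply.
apply: (sub (ideal_gen [set x])); last exact: ideal_gen_gen.
apply: ideal_gen_closed; apply/negP => /ideal_genP[k [a [y [yx e]]]].
apply: nox; exists (\sum_i a i); rewrite e mulr_sumr; apply: eq_bigr => i _.
by rewrite mulrC (yx i).
Qed.

(** If I is not prime, take u v in I with u, v outside I. The primes found for I + (u) and I + (v)
    together serve for I, because the product of these two ideals lies in I. *)
Lemma radical_primes I : noetherian R -> idealr_closed I ->
  exists (T : finType) (Q : T -> prime_idealr R),
    forall x, (forall t, x \in Q t) -> exists k, x ^+ k \in I.
Proof.
move=> nR; move: I; apply: noetherian_ind => // I cI IH.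
have [I0 I1 IM] := cI.
have [/prime_idealP[Q ->]|nI] := pselect (prime_ideal I).
  by exists unit, (fun=> Q) => x /(_ tt) xQ; exists 1%N.
have [u [v [uv uI vI]]] : exists u v, [/\ u * v \in I, u \notin I & v \notin I].
  apply: contrapT => no; apply: nI; split=> // u v uv.
  rewrite -[_ || _]negbK negb_or; apply/negP => /andP[uI vI].
  by apply: no; exists u, v.
pose add w : {pred R} := fun z => `[< exists a y, y \in I /\ z = a * w + y >].
have addP w : w \notin I -> exists (T : finType) (Q : T -> prime_idealr R),
    forall x, (forall t, x \in Q t) -> exists k, x ^+ k \in add w.
  move=> wI; have addM a x y : x \in add w -> y \in add w -> a * x + y \in add w.
    move=> /asboolP[b [z [zI ->]]] /asboolP[c [t [tI ->]]]; apply/asboolP.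
    exists (a * b + c), (a * z + t); split; first exact: IM.
    by rewrite mulrDr mulrDl !mulrA addrACA.
  have wadd : w \in add w by apply/asboolP; exists 1, 0; rewrite mul1r addr0.
  (* When I + (w) is the unit ideal, the empty family and the exponent 0 suffice. *)
  have [a1|a1] := boolP (1 \in add w).
    exists void, (fun t : void => match t with end) => x _.
    by exists 0%N; rewrite expr0.
  apply: IH.
  - by split=> //; apply/asboolP; exists 0, 0; rewrite mul0r addr0.
  - by move=> y yI; apply/asboolP; exists 0, y; rewrite mul0r add0r.
  - by move=> /(_ w wadd); apply/negP.
have [[T [Q QP]] [T' [Q' QP']]] := (addP u uI, addP v vI).
exists (T + T')%type, (fun t => match t with inl a => Q a | inr b => Q' b end).
move=> x xQ.
have [k /asboolP[a [y [yI xu]]]] := QP x (fun t => xQ (inl t)).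
have [l /asboolP[b [z [zI xv]]]] := QP' x (fun t => xQ (inr t)).
exists (k + l)%N; rewrite exprD xu xv.
have -> : (a * u + y) * (b * v + z) =
    (a * b) * (u * v) + ((a * u + y) * z + ((b * v) * y + 0)).
  by rewrite mulrDr mulrDl addr0 -addrA [y * _]mulrC [_ * z + _]addrC mulrACA.
exact: IM (IM _ _ _ zI (IM _ _ _ yI I0)).
Qed.

End IdealGen.

(** In a reduced ring [radical_primes] at the zero ideal gives finitely many primes with
    intersection 0. Every prime contains one of them, so the minimal primes are the minimal members
    of this family. *)
Lemma minimal_primes (R : comNzRingType) : noetherian R -> reduced R ->
  exists (n : nat) (Q : 'I_n -> prime_idealr R),
  [/\ forall i, MinSpec (Q i),
      forall P, MinSpec P -> exists i, P = Q i,
      forall i j, Q i = Q j :> {pred R} -> i = j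
    & forall x, (forall i, x \in Q i) -> x = 0].
Proof.
move=> nR redR.
have [|T [Q QP]] := radical_primes (I := fun x : R => x == 0) nR.
  split; rewrite ?unfold_in ?eqxx ?oner_eq0 // => a u v /eqP -> /eqP ->.
  by rewrite unfold_in mulr0 addr0.
have {}Q0 x : (forall t, x \in Q t) -> x = 0.
  by move=> /QP[k /eqP]; apply: redR.
(* Otherwise a product of elements of the Q_t outside P would be 0 and yet not in P. *)
have contains (P : prime_idealr R) : exists t, {subset Q t <= P}.
  apply: contrapT => /forallNP noQ.
  have /choice[y yP] : forall t, exists y, y \in Q t /\ y \notin P.
    move=> t; apply: contrapT => noy; apply: (noQ t) => y yQ.
    by apply: contrapT => /negP yP; apply: noy; exists y.
  have : \prod_t y t \notin P.
    elim/big_rec: _ => [|t z _ zP]; first by rewrite idealr1.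
    by rewrite prime_idealrM negb_or zP (yP t).2.
  by rewrite (Q0 (\prod_t y t)) ?rpred0 // => t; rewrite (bigD1 t) //= mulrC idealMr ?(yP t).1.
have spec (P : prime_idealr R) : Spec P.
  split; first by split; rewrite ?rpred0 ?idealr1 // => a u v uP vP; rewrite rpredD ?idealMr.
  by move=> u v; rewrite prime_idealrM.
pose le s t := `[< {subset Q s <= Q t} >].
(* Among the members below Q_t, one with fewest members below it is minimal. *)
have below t : exists2 s, MinSpec (Q s) & {subset Q s <= Q t}.
  have [s /asboolP st smin] := @arg_minnP _ t (fun s => le s t)
    (fun s => #|[pred r | le r s]|) (asboolT (fun x h => h)).
  exists s => //; split=> // P sP Ps x; apply/idP/idP => [/Ps //|].
  have [P' PP'] := prime_idealP sP; have [r rP] := contains P'.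
  have rs : {subset Q r <= Q s} by move=> z /rP; rewrite -PP'; apply: Ps.
  suff /asboolP/(_ x) sr : le s r by move=> /sr/rP; rewrite PP'.
  apply: contrapT => /negP nsr.
  have /smin : le r t by apply/asboolP => z /rs/st.
  rewrite leqNgt => /negP; apply; apply/proper_card/properP; split.
    apply/fintype.subsetP => q /asboolP qr; suff : le q s by [].
    by apply/asboolP => z zq; apply/rs/qr.
  by exists s; rewrite !inE //; apply: asboolT.
(* Repetitions are removed by keeping the first index of each minimal prime. *)
pose good t := `[< MinSpec (Q t) /\ forall s, (enum_rank s < enum_rank t)%N ->
   (Q s : {pred R}) <> Q t >].
pose J : finType := {t : T | good t}; pose QJ (i : 'I_#|J|) := Q (val (enum_val i)).
have goodP i : MinSpec (QJ i) /\ forall s, (enum_rank s < enum_rank (val (enum_val i)))%N ->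
    (Q s : {pred R}) <> QJ i.
  by rewrite /QJ; case: (enum_val i) => t /= /asboolP.
have surj t : MinSpec (Q t) -> exists i, QJ i = Q t :> {pred R}.
  move=> minQ; have [s /asboolP st smin] := @arg_minnP _ t
    (fun s => `[< (Q s : {pred R}) = Q t >]) (fun s => enum_rank s : nat) (asboolT erefl).
  have gs : good s.
    apply/asboolP; rewrite st; split=> // r; rewrite ltnNge => /negP rs rt.
    by apply/rs/smin/asboolP.
  by exists (enum_rank (Sub s gs : J)); rewrite /QJ enum_rankK.
exists #|J|, QJ; split.
- by move=> i; case: (goodP i).
- move=> P [sP Pmin]; have [P' PP'] := prime_idealP sP; subst P.
  have [t tP] := contains P'; have [s minQ st] := below t.
  have [i iE] := surj s minQ; exists i; rewrite iE; apply/funext => x.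
  exact/esym/(Pmin (Q s) (spec _) (fun z zs => tP _ (st _ zs)) x).
- move=> i j ij; apply: enum_val_inj; apply: val_inj; apply: enum_rank_inj.
  apply: val_inj; apply/eqP; rewrite eqn_leq leqNgt [X in _ && X]leqNgt.
  apply/andP; split; apply/negP => /(proj2 (goodP _)); apply; exact/esym.
- move=> x xQ; apply: Q0 => t; have [s minQ st] := below t.
  by have [i iE] := surj s minQ; apply: st; rewrite -iE.
Qed.

(** * The glued subring *)

Section Glue.
Context (B : comNzRingType) (M : idealr B) (n m : nat).
Context (Q : 'I_n -> prime_idealr B) (cl : 'I_n -> 'I_m) (R : subringClosed B).

Definition regular (a : B) : Prop := forall i, a \notin Q i.

(* The elements whose image in each product of the fields Frac(B/Q_i), over the
   indices i of one class, is a fraction of elements of R. *)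
Definition glue : {pred B} := fun s => `[< forall j, exists r d,
  [/\ r \in R, d \in R, d <> 0 & forall i, cl i = j -> d * s - r \in Q i] >].

Hypothesis unitM : forall x, x \notin M -> exists y, x * y = 1.
Hypothesis QM : forall i, {subset Q i <= M}.
Hypothesis Q_sep : forall i k, i != k -> exists2 x, x \in Q k & x \notin Q i.
Hypothesis Q_cap : forall x, (forall i, x \in Q i) -> x = 0.
Hypothesis cl_surj : forall j, exists i, cl i = j.
Hypothesis R_cap : forall i z, z \in R -> z \in Q i -> z = 0.
Hypothesis R_dense : forall a b, regular a -> exists2 y, y \in M & b + a * y \in R.

Lemma glueP s : reflect (forall j, exists r d,
  [/\ r \in R, d \in R, d <> 0 & forall i, cl i = j -> d * s - r \in Q i]) (s \in glue).
Proof. exact: asboolP. Qed.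

Lemma R_regular z : z \in R -> z <> 0 -> regular z.
Proof. by move=> zR z0 i; apply/negP => /(R_cap zR). Qed.

Lemma regularM a b : regular a -> regular b -> regular (a * b).
Proof. by move=> ra rb i; rewrite prime_idealrM negb_or ra rb. Qed.

Lemma regular_unit x : x \notin M -> regular x.
Proof. by move=> xM i; apply: contra xM; apply: QM. Qed.

Lemma shift1M y : y \in M -> 1 + y \notin M.
Proof. by move=> yM; apply/negP => /rpredB/(_ yM); rewrite addrK idealr1. Qed.

Lemma R_neq0M (i0 : 'I_n) d d' : d \in R -> d' \in R -> d <> 0 -> d' <> 0 -> d * d' <> 0.
Proof.
move=> dR d'R d0 d'0 dd; have := regularM (R_regular dR d0) (R_regular d'R d'0) i0.
by rewrite dd rpred0.
Qed.

Lemma R_glue : {subset R <= glue}.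
Proof.
move=> s sR; apply/glueP => j; exists s, 1; split; rewrite ?rpred1 //.
  by apply/eqP/oner_neq0.
by move=> i _; rewrite mul1r subrr rpred0.
Qed.

Lemma glue_closed : subring_closed glue.
Proof.
split; first exact/R_glue/rpred1.
- move=> s t /glueP sP /glueP tP; apply/glueP => j; have [i0 _] := cl_surj j.
  have [r [d [rR dR d0 dP]]] := sP j; have [r' [d' [r'R d'R d'0 d'P]]] := tP j.
  exists (d' * r - d * r'), (d * d'); split; rewrite ?rpredB ?rpredM //.
    exact: R_neq0M.
  move=> i ij; have -> : d * d' * (s - t) - (d' * r - d * r') =
      d' * (d * s - r) - d * (d' * t - r').
    rewrite !mulrBr -!mulrA (mulrCA d' d s) !opprB addrACA [RHS]addrACA.
    by congr (_ + _); apply: addrC.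
  by rewrite rpredB ?idealMr ?dP ?d'P.
- move=> s t /glueP sP /glueP tP; apply/glueP => j; have [i0 _] := cl_surj j.
  have [r [d [rR dR d0 dP]]] := sP j; have [r' [d' [r'R d'R d'0 d'P]]] := tP j.
  exists (r * r'), (d * d'); split; rewrite ?rpredM //; first exact: R_neq0M.
  move=> i ij; have -> : d * d' * (s * t) - r * r' =
      d' * t * (d * s - r) + r * (d' * t - r').
    rewrite !mulrBr [r * (d' * t)]mulrC subrKA; congr (_ - _).
    by rewrite [RHS]mulrACA (mulrC d') (mulrC t).
  by rewrite rpredD ?idealMr ?dP ?d'P.
Qed.

HB.instance Definition _ := GRing.isSubringClosed.Build B glue glue_closed.

(** If a = r/d and ab = r'/d' on a class, then b = dr'/(rd'). Regularity of a makes r nonzero, as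
    the class is not empty. *)
Lemma glue_div a b : a \in glue -> regular a -> a * b \in glue -> b \in glue.
Proof.
move=> /glueP aP ra /glueP abP; apply/glueP => j; have [i0 i0j] := cl_surj j.
have [r [d [rR dR d0 dP]]] := aP j; have [r' [d' [r'R d'R d'0 d'P]]] := abP j.
exists (d * r'), (r * d'); split; rewrite ?rpredM //.
  apply: R_neq0M => // r0; have := dP _ i0j; rewrite r0 subr0 prime_idealrM.
  by rewrite (negPf (R_regular dR d0 i0)) (negPf (ra i0)).
move=> i ij; have -> : r * d' * b - d * r' = d * (d' * (a * b) - r') - d' * b * (d * a - r).
  have dab : d' * b * (d * a) = d * (d' * (a * b)).
    by rewrite mulrACA (mulrC d') (mulrC b) mulrA.
  by rewrite !mulrBr opprB [RHS]addrC dab subrKA -mulrA mulrC.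
by rewrite rpredB ?idealMr ?dP ?d'P.
Qed.

(** If s = r/d on the class and s is in Q_i, then r lies in R and in Q_i, so r = 0. Hence ds is in
    Q_k, while d is not. *)
Lemma glue_class s i k : s \in glue -> cl i = cl k -> s \in Q i -> s \in Q k.
Proof.
move=> /glueP/(_ (cl k))[r [d [rR dR d0 dP]]] ik sQ.
have r0 : r = 0.
  apply: (R_cap (i := i)) => //; rewrite -(subKr (d * s) r) rpredB ?dP //.
  exact: idealMr.
have := dP k erefl; rewrite r0 subr0 prime_idealrM.
by rewrite (negPf (R_regular dR d0 k)).
Qed.

Lemma glue_dense a b : regular a -> exists2 y, y \in M & b + a * y \in glue.
Proof. by move=> /(R_dense b)[y yM yR]; exists y => //; apply: R_glue. Qed.

Lemma glue_inv x : x \in glue -> x \notin M -> exists2 y, y \in glue & x * y = 1.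
Proof.
move=> xG xM; have [y xy] := unitM xM; exists y => //.
by apply: (glue_div xG (regular_unit xM)); rewrite xy rpred1.
Qed.

(** e_i is a product, over k different from i, of elements of Q_k outside Q_i. *)
Lemma minimal_separator : exists e : 'I_n -> B, forall i k, (e i \in Q k) = (i != k).
Proof.
have /choice[x xP] : forall ik : 'I_n * 'I_n, exists x, ik.1 != ik.2 ->
    x \in Q ik.2 /\ x \notin Q ik.1.
  move=> [i k] /=; have [_|/Q_sep[x xk xi]] := eqVneq i k; first by exists 0.
  by exists x.
exists (fun i => \prod_(k | i != k) x (i, k)) => i k.
have [<-|ik] := eqVneq i k; last first.
  by rewrite (bigD1 k) //= mulrC idealMr //; case: (xP (i, k)).
apply/negbTE; elim/big_ind: _ => [|u v uQ vQ|k' ik'].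
- by rewrite idealr1.
- by rewrite prime_idealrM negb_or uQ vQ.
- by case: (xP (i, k')).
Qed.

(** Let e0_j be the sum of the e_i over class j. The sum g of all e0_j is regular and agrees with
    e0_j on class j. Density gives a unit 1 + y with g(1 + y) in R, so e0_j(1 + y) equals an element
    of R on class j and 0 on the others. *)
Lemma class_separator j : exists2 e, e \in glue & forall i, (e \in Q i) = (cl i != j).
Proof.
have [e eE] := minimal_separator.
pose e0 j' := \sum_(i | cl i == j') e i.
have e0E j' k : (e0 j' \in Q k) = (cl k != j').
  have [kj|kj] := eqVneq (cl k) j'; last first.
    apply: rpred_sum => i /eqP ij; rewrite eE; apply: contraNneq kj => <-.
    by rewrite ij.
  apply/negbTE; rewrite /e0 (bigD1 k) ?kj //=; apply/negP => ekQ.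
  have := eE k k; rewrite eqxx => /negP; apply.
  rewrite -(addrK (\sum_(i | (cl i == j') && (i != k)) e i) (e k)).
  by rewrite rpredB // rpred_sum // => i /andP[_ ik]; rewrite eE.
pose g := \sum_j' e0 j'.
have gE k : g - e0 (cl k) \in Q k.
  rewrite /g (bigD1 (cl k)) //= addrAC subrr add0r rpred_sum // => j' jk.
  by rewrite e0E eq_sym.
have rg : regular g.
  move=> k; apply/negP => gQ; have := e0E (cl k) k; rewrite eqxx => /negP; apply.
  by rewrite -(subKr g (e0 _)) rpredB.
have [y yM gyR] := R_dense g rg.
have y1 := regular_unit (shift1M yM).
exists (e0 j * (1 + y)); last first.
  by move=> i; rewrite prime_idealrM (negPf (y1 i)) orbF e0E.
apply/glueP => j'; have [->|jj'] := eqVneq j' j.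
  exists (g + g * y), 1; split; rewrite ?rpred1 //; first exact/eqP/oner_neq0.
  move=> i ij; rewrite mul1r -{1}[g]mulr1 -mulrDr -mulrBl mulrC idealMr //.
  by rewrite -opprB rpredN -ij.
exists 0, 1; split; rewrite ?rpred1 ?rpred0 //; first exact/eqP/oner_neq0.
move=> i ij; rewrite mul1r subr0 mulrC idealMr // e0E ij.
by apply: contraNneq jj' => ->.
Qed.

(** Prime avoidance: with p_i in P outside Q_i, the sum of the e_i p_i is congruent to e_k p_k
    modulo Q_k. *)
Lemma regular_in (P : prime_idealr B) :
  (forall i, ~ {subset P <= Q i}) -> exists2 a, a \in P & regular a.
Proof.
move=> PQ; have [e eE] := minimal_separator.
have /choice[p pP] : forall i, exists p, p \in P /\ p \notin Q i.
  move=> i; apply: contrapT => nop; apply: (PQ i) => x xP.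
  by apply: contrapT => /negP xQ; apply: nop; exists x.
exists (\sum_i e i * p i).
  by apply: rpred_sum => i _; apply: idealMr; case: (pP i).
move=> k; rewrite (bigD1 k) //=; set z := \sum_(i | i != k) _.
have zQ : z \in Q k.
  by apply: rpred_sum => i ik; rewrite mulrC idealMr // eE.
apply/negP => /rpredB/(_ zQ); rewrite addrK prime_idealrM eE eqxx /=.
by apply/negP; case: (pP k).
Qed.

End Glue.

(** * Completions and heights *)

Section Completion.
Context (S B : comNzRingType) (f : {rmorphism S -> B}) (N : idealr S) (M : idealr B).
Hypothesis fN : forall k s, (f s \in ideal_powS M k) = (s \in ideal_powS N k).
Hypothesis f_dense : forall k b, exists s, b - f s \in ideal_powS M k.

(** One direction makes the map induced by f on the quotients well defined, the other makes it
    injective. *)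
Lemma pi_powS k u v : (\pi_(quot_pow N k) u = \pi_(quot_pow N k) v) <->
  \pi_(quot_pow M k) (f u) = \pi_(quot_pow M k) (f v).
Proof.
by split=> /eqP; rewrite -Quotient.idealrBE => h; apply/eqP;
  rewrite -Quotient.idealrBE; move: h; rewrite -rmorphB fN.
Qed.

Lemma compl_coherent (x : completion N) k :
  quot_pow_step (\pi_(quot_pow M k.+1) (f (repr (comp_proj x k.+1)))) =
  \pi_(quot_pow M k) (f (repr (comp_proj x k))).
Proof.
by rewrite quot_pow_step_pi; apply/pi_powS; rewrite reprK -[RHS]comp_coherent.
Qed.

Definition compl_map (x : completion N) : completion M :=
  Completion (compl_coherent x).

Lemma compl_mapE (x : completion N) k r :
  comp_proj x k = \pi_(quot_pow N k) r ->
  comp_proj (compl_map x) k = \pi_(quot_pow M k) (f r).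
Proof. by move=> xr /=; apply/pi_powS; rewrite reprK. Qed.

Lemma compl_zmod : zmod_morphism compl_map.
Proof.
move=> x y; apply: completionP => k.
rewrite (@compl_mapE _ k (repr (comp_proj x k) - repr (comp_proj y k))).
  by rewrite rmorphB rmorphB.
by rewrite rmorphB /= !reprK.
Qed.

Lemma compl_monoid : monoid_morphism compl_map.
Proof.
split=> [|x y]; apply: completionP => k.
  by rewrite (@compl_mapE _ k 1) ?rmorph1.
rewrite (@compl_mapE _ k (repr (comp_proj x k) * repr (comp_proj y k))).
  by rewrite rmorphM rmorphM.
by rewrite rmorphM /= !reprK.
Qed.

Lemma compl_bij : bijective compl_map.
Proof.
have inj : injective compl_map.
  move=> x y xy; apply: completionP => k.
  have /pi_powS := congr1 (fun z => comp_proj z k) xy.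
  by rewrite !reprK.
have surj (z : completion M) : exists x, compl_map x = z.
  have /choice[s sP] k : exists s, \pi_(quot_pow M k) (f s) = comp_proj z k.
    have [s zs] := f_dense k (repr (comp_proj z k)); exists s.
    by rewrite -[RHS]reprK; apply/esym/eqP; rewrite -Quotient.idealrBE.
  (* Lifts chosen level by level are coherent because the maps of quotients are injective. *)
  have coh k : quot_pow_step (\pi_(quot_pow N k.+1) (s k.+1)) = \pi_(quot_pow N k) (s k).
    by rewrite quot_pow_step_pi; apply/pi_powS; rewrite sP -comp_coherent -sP quot_pow_step_pi.
  exists (Completion coh); apply: completionP => k.
  by rewrite (@compl_mapE _ k (s k)) // sP.
have [g gP] := choice surj; exists g => // x.
by apply: inj; rewrite gP.
Qed.

Lemma same_completion_powS : same_completion f N M.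
Proof.
pose h1 := GRing.isZmodMorphism.Build _ _ compl_map compl_zmod.
pose h2 := GRing.isMonoidMorphism.Build _ _ compl_map compl_monoid.
exists (HB.pack_for {rmorphism completion N -> completion M} compl_map h1 h2).
by split; [move=> x k r; apply: compl_mapE|exact: compl_bij].
Qed.

End Completion.

Section Height.
Context (R : comNzRingType).

Lemma height_gt0P (P : {pred R}) :
  (0%:E < height P)%E <-> exists2 k, (0 < k)%N & exists c, prime_chain P k c.
Proof.
rewrite /height; set A := [set k | exists c, prime_chain P k c]%classic.
set E := image _ _; split.
- move=> h; apply: contrapT => noc.
  (* Without chains of positive length the set of lengths is empty or {0}, with supremum -oo or
     0. *)
  have E0 x : E x -> x = 0%:E.
    move=> [k Ak <-]; case: k Ak => // k Ak; case: noc; by exists k.+1.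
  have [EE|/set0P[x Ex]] := eqVneq E set0.
    by move: h; rewrite EE supremum0.
  have EE : E = [set 0%:E].
    by apply/seteqP; split=> [y /E0 //|y ->]; rewrite -(E0 _ Ex).
  by move: h; rewrite EE supremum1 ltxx.
- move=> [k k0 Ak].
  have Ek : E (k%:Z%:E)%E by exists k.
  apply: (@lt_le_trans _ _ (k%:Z%:E)%E); first by rewrite lte_fin.
  apply: (ge_supremum_Nmem _ _ Ek).
  (* [supremum] is known to bound the set once a least upper bound exists: the greatest length if
     lengths are bounded, +oo otherwise. *)
  have [ubA|nub] := pselect (ubound A !=set0).
    have [s [sub slub]] := nat_supremums_neq0 ubA; exists (s%:Z%:E)%E; split.
      by move=> _ [j Aj <-]; rewrite lee_fin lez_nat; apply: sub.
    move=> u uE; have As : A s.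
      apply: contrapT => nAs; case: s sub slub nAs => [|s] sub slub nAs.
        by have := sub _ Ak; rewrite leNgt ltEnat /= k0.
      have : (s.+1 <= s)%O.
        apply: slub => j Aj; have := sub _ Aj; rewrite leEnat /= leq_eqVlt.
        by case: eqP Aj nAs => [-> //|_ _ _]; rewrite ltnS.
      by rewrite leEnat ltnn.
    by apply: uE; exists s.
  exists +oo%E; split; first by move=> x _; rewrite leey.
  move=> [u|//|] uE; last first.
    by have := uE _ Ek; rewrite leeNy_eq.
  exfalso; apply: nub; exists `|u|%N => j Aj.
  have : (j%:Z%:E <= u%:E)%E by apply: uE; exists j.
  by rewrite lee_fin leEnat /= => ju; rewrite -lez_nat (le_trans ju) // lez_abs.
Qed.

End Height.

(** * Ideals of the glued subring *)

Section GluedSubring.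
Context (B : comNzRingType) (M : idealr B) (n m : nat).
Context (Q : 'I_n -> prime_idealr B) (cl : 'I_n -> 'I_m).
Context (D : {pred B}) (S : subComNzRingType D).
Let v : {rmorphism S -> B} := \val.
Let N : idealr S := ideal_contr v M.

Hypothesis noethB : noetherian B.
Hypothesis redB : reduced B.
Hypothesis QM : forall i, {subset Q i <= M}.
Hypothesis Q_cap : forall x, (forall i, x \in Q i) -> x = 0.
Hypothesis cl_surj : forall j, exists i, cl i = j.
Hypothesis D_div : forall a b, a \in D -> regular Q a -> a * b \in D -> b \in D.
Hypothesis D_class : forall s i k, s \in D -> cl i = cl k -> s \in Q i -> s \in Q k.
Hypothesis D_dense : forall a b, regular Q a -> exists2 y, y \in M & b + a * y \in D.
Hypothesis D_inv : forall x, x \in D -> x \notin M -> exists2 y, y \in D & x * y = 1.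
Hypothesis D_sep : forall j, exists2 e, e \in D & forall i, (e \in Q i) = (cl i != j).
Hypothesis D_max : (exists2 a, a \in M & regular Q a) \/ forall b, b \in D.

Lemma subring_val_inj : injective v. Proof. exact: val_inj. Qed.

Lemma subring_valP s : v s \in D. Proof. exact: valP. Qed.

Lemma exists_val b : b \in D -> exists s, v s = b.
Proof. by move=> bD; exists (Sub b bD : S); exact: SubK. Qed.

(** With [val_div] this says, for regular a in S, that B = S + aB and that S meets aB in aS; hence
    S/aS = B/aB. *)
Lemma val_dense a b : regular Q a -> exists s y, y \in M /\ b = v s + a * y.
Proof.
move=> /(D_dense b)[y yM /exists_val[s sE]]; exists s, (- y).
by rewrite rpredN sE mulrN addrK.
Qed.

Lemma val_div (a : S) b c : regular Q (v a) -> v c = v a * b -> exists2 d, v d = b & c = a * d.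
Proof.
move=> ra cE; have [|d dE] := @exists_val b.
  by apply: (D_div (subring_valP a) ra); rewrite -cE subring_valP.
by exists d => //; apply: subring_val_inj; rewrite rmorphM dE.
Qed.

Lemma val_separator : exists e : 'I_m -> S, forall j i, (v (e j) \in Q i) = (cl i != j).
Proof.
suff /choice[e eP] : forall j, exists e, forall i, (v e \in Q i) = (cl i != j) by exists e.
by move=> j; have [e /exists_val[s <-] eP] := D_sep j; exists s.
Qed.

Lemma unit_subring (x : S) : x \notin N -> exists y, x * y = 1.
Proof.
move=> xN; have [y /exists_val[s <-] xy] := D_inv (subring_valP x) xN.
by exists s; apply: subring_val_inj; rewrite rmorphM rmorph1.
Qed.

Lemma ideal_sub_max (I : {pred S}) : idealr_closed I -> {subset I <= N}.
Proof.
move=> [I0 I1 IM] x xI; apply: contrapT => /negP/unit_subring[y xy].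
by move/negP: I1; apply; rewrite -xy mulrC -[_ * _]addr0 IM.
Qed.

Lemma contr_max_closed : idealr_closed N.
Proof. by split; [exact: rpred0|rewrite idealr1|move=> a x y xN yN; rewrite rpredD ?idealMr]. Qed.

Lemma quasi_local_subring : quasi_local N.
Proof.
split.
  split; first exact: contr_max_closed.
  by move=> J cJ NJ x; apply/idP/idP; [apply: ideal_sub_max|apply: NJ].
move=> J [cJ maxJ] x; apply/esym/maxJ; first exact: contr_max_closed.
exact: ideal_sub_max.
Qed.

(** Writing each coefficient as c_i + a z_i with c_i in S leaves an element of S in aB, hence in
    aS. *)
Lemma ext_contr_mod (a x : S) (A : set S) : regular Q (v a) ->
  v x \in ideal_gen (v @` A) -> exists d, x - a * d \in ideal_gen A.
Proof.
move=> ra /ideal_genP[k [b [y [yA xE]]]].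
have /choice[c cP] : forall i, exists cz : S * B, b i = v cz.1 + v a * cz.2.
  by move=> i; have [c [z [_ ->]]] := val_dense (b i) ra; exists (c, z).
have /choice[u uP] : forall i, exists u, A u /\ y i = v u.
  by move=> i; have [u Au <-] := yA i; exists u.
have [d _ xd] : exists2 d, v d = \sum_i (c i).2 * y i & x - \sum_i (c i).1 * u i = a * d.
  apply: val_div => //; rewrite rmorphB rmorph_sum xE /= -sumrB mulr_sumr.
  apply: eq_bigr => i _; rewrite cP rmorphM (uP i).2 mulrDl mulrA.
  by rewrite [v _ * _ + _]addrC addrK.
exists d; rewrite -xd subKr; apply: ideal_gen_sum => i.
by apply: ideal_gen_gen; case: (uP i).
Qed.

(** The extension IB has finitely many generators taken from I; by [ext_contr_mod] these and a
    generate I. *)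
Lemma regular_fg (I : {pred S}) (a : S) : idealr_closed I -> a \in I -> regular Q (v a) ->
  exists s : seq S, {subset s <= I} /\ {subset I <= ideal_gen [set` s]}.
Proof.
move=> cI aI ra; pose A : set B := [set v x | x in [set` I]].
have cM : idealr_closed M.
  by split; [exact: rpred0|rewrite idealr1|move=> b x y xN yN; rewrite rpredD ?idealMr].
have [|s sA As] := noetherian_fg (A := A) noethB cM.
  by move=> _ [x xI <-]; apply: (ideal_sub_max cI xI).
have {sA} [t tI st] : exists2 t, {subset t <= I} & s = map v t.
  elim: s sA {As} => [|x s IHs] sA; first by exists [::].
  have [|t tI ->] := IHs; first by move=> y ys; apply: sA; rewrite inE ys orbT.
  have [y yI <-] : A x by apply: sA; rewrite inE eqxx.
  by exists (y :: t) => // z; rewrite inE => /predU1P[->|/tI].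
exists (a :: t); split=> [z|x xI]; first by rewrite inE => /predU1P[->|/tI].
have /As : v x \in ideal_gen A by apply: ideal_gen_gen; exists x.
have -> : [set` s] = v @` [set` t].
  apply/seteqP; split=> y; rewrite /= st; first by move=> /mapP[u ut ->]; exists u.
  by move=> [u ut <-]; apply: map_f.
move=> /(ext_contr_mod ra)[d]; rewrite mulrC => xd; rewrite -(subrK (d * a) x) addrC.
apply: ideal_genD; first by apply: ideal_gen_gen; rewrite /= inE eqxx.
move: xd; apply: ideal_gen_le => u ut; apply: ideal_gen_gen.
by rewrite /= inE; apply/orP; right.
Qed.

Lemma reduced_subring : reduced S.
Proof.
move=> x k xk; apply: subring_val_inj; rewrite rmorph0; apply: (@redB _ k).
by rewrite -rmorphXn xk rmorph0.
Qed.

(* I need not contain a regular element, but the direct sum I + Ann(I) does. *)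
Lemma noetherian_subring : noetherian S.
Proof.
move=> I cI; have [I0 I1 IM] := cI.
have II x a : x \in I -> a * x \in I by move=> xI; rewrite -[_ * _]addr0 IM.
have ID x y : x \in I -> y \in I -> x + y \in I by move=> xI yI; rewrite -[x]mul1r IM.
suff [s [sI Is]] : exists s : seq S, {subset s <= I} /\ {subset I <= ideal_gen [set` s]}.
  exists s => x; apply/idP/idP; [exact: Is|apply: ideal_gen_sub => // y; exact: sI].
pose W : {pred S} := fun w => `[< forall x, x \in I -> w * x = 0 >].
have W0 : 0 \in W by apply/asboolP => x _; rewrite mul0r.
have WD a x y : x \in W -> y \in W -> a * x + y \in W.
  by move=> /asboolP xW /asboolP yW; apply/asboolP => z zI;
    rewrite mulrDl -mulrA xW // yW // mulr0 addr0.
pose J : {pred S} := fun z => `[< exists x w, [/\ x \in I, w \in W & z = x + w] >].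
have JM a x y : x \in J -> y \in J -> a * x + y \in J.
  move=> /asboolP[x1 [w1 [x1I w1W ->]]] /asboolP[x2 [w2 [x2I w2W ->]]].
  apply/asboolP; exists (a * x1 + x2), (a * w1 + w2); split; [exact: IM|exact: WD|].
  by rewrite mulrDr addrACA.
have J0 : 0 \in J by apply/asboolP; exists 0, 0; rewrite addr0.
have [s sJ Js] : exists2 s : seq S, {subset s <= J} & {subset J <= ideal_gen [set` s]}.
  (* [regular_fg] concerns proper ideals, so the unit ideal is treated apart. *)
  have [J1|J1] := boolP (1 \in J).
    exists [:: 1] => [x|x _]; first by rewrite inE => /eqP ->.
    apply/ideal_genP; exists 1%N, (fun=> x), (fun=> 1); split=> [_|]; first by rewrite /= inE.
    by rewrite big_ord1 mulr1.
  suff [a aJ ra] : exists2 a, a \in J & regular Q (v a).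
    by have [|s [sJ Js]] := regular_fg _ aJ ra; [split|exists s].
  have [e eP] := val_separator.
  (* By [D_class], an element of I outside one prime of a class is outside all of them. So each
     class either has such an element or has all its primes containing I. *)
  have /choice[x xP] : forall j, exists x : S, x \in I /\
      ((forall i, cl i = j -> v x \notin Q i) \/
       (forall y, y \in I -> forall i, cl i = j -> v y \in Q i)).
    move=> j; have [[x xI xj]|nox] := pselect (exists2 x, x \in I &
      exists2 i, cl i = j & v x \notin Q i).
      exists x; split=> //; left=> k kj; have [i ij xi] := xj.
      by apply: contra xi; apply: D_class; rewrite ?subring_valP // kj.
    exists 0; split=> //; right=> y yI i ij; apply: contrapT => /negP yQ.
    by apply: nox; exists y => //; exists i.
  pose ann j := `[< forall y, y \in I -> forall i, cl i = j -> v y \in Q i >].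
  (* The first sum lies in I and the second annihilates I. Modulo Q_i only the term of the class of
     i survives, and it is nonzero. *)
  exists (\sum_(j | ~~ ann j) e j * x j + \sum_(j | ann j) e j).
    apply/asboolP; exists (\sum_(j | ~~ ann j) e j * x j), (\sum_(j | ann j) e j).
    split=> //; first by elim/big_ind: _ => // j _; apply: II; case: (xP j).
    elim/big_ind: _ => // [y z yW zW|j /asboolP annj]; first by rewrite -[y]mul1r WD.
    apply/asboolP => z zI; apply: subring_val_inj; rewrite rmorph0; apply: Q_cap => i.
    rewrite rmorphM prime_idealrM eP; case: eqVneq => //= ij; exact: annj.
  move=> i; rewrite rmorphD !rmorph_sum /=.
  have [anni|nanni] := boolP (ann (cl i)).
    rewrite (bigD1 (cl i) anni) /= addrCA.
    have -> : \sum_(j | ~~ ann j) v (e j * x j) + \sum_(j | ann j && (j != cl i)) v (e j)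
        = - (- (\sum_(j | ~~ ann j) v (e j * x j) + \sum_(j | ann j && (j != cl i)) v (e j))).
      by rewrite opprK.
    set z := - (_ + _); have zQ : z \in Q i.
      rewrite /z rpredN rpredD // rpred_sum // => j; last first.
        by move=> /andP[_ jc]; rewrite eP eq_sym.
      move=> nj; rewrite rmorphM prime_idealrM eP.
      by case: eqVneq nj => //= <-; rewrite anni.
    apply/negP => /rpredD/(_ zQ); rewrite subrK eP eqxx //.
  rewrite (bigD1 (cl i) nanni) /= -addrA.
  set z := _ + \sum_(j | ann j) _; have zQ : z \in Q i.
    rewrite /z rpredD // rpred_sum // => j.
      move=> /andP[_ jc]; rewrite rmorphM prime_idealrM eP.
      by rewrite eq_sym jc.
    by move=> nj; rewrite eP; apply: contraNneq nanni => ->.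
  apply/negP => /rpredB/(_ zQ); rewrite addrK rmorphM prime_idealrM eP eqxx /=.
  apply/negP; have [_ [|annj]] := xP (cl i); first exact.
  by case/asboolP: nanni.
have /choice[xw xwP] : forall z, exists xw : S * S, z \in J ->
    [/\ xw.1 \in I, xw.2 \in W & z = xw.1 + xw.2].
  move=> z; have [/asboolP[x [w xwP]]|zJ] := boolP (z \in J); first by exists (x, w).
  by exists (0, 0).
exists [seq (xw z).1 | z <- s]; split=> [_ /mapP[z /sJ/xwP[? _ _] ->] //|x xI].
have /Js/ideal_genP[k [a [y [ys xE]]]] : x \in J.
  by apply/asboolP; exists x, 0; rewrite addr0.
have yP i := xwP _ (sJ _ (ys i)).
suff -> : x = \sum_i a i * (xw (y i)).1.
  apply: ideal_gen_sum => i; apply: ideal_gen_gen; apply/mapP; exists (y i) => //.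
  exact: ys.
(* The difference x - x' lies in I and annihilates I, so its square is 0. *)
set x' := \sum_i _; apply/eqP; rewrite -subr_eq0; apply/eqP/(@reduced_subring _ 2).
have x'I : x - x' \in I.
  apply: (ID) => //; rewrite -mulN1r; apply: (II); rewrite /x'.
  elim/big_ind: _ => [//|z t zI tI|i _]; first exact: ID.
  by apply: II; case: (yP i).
have /asboolP xW : x - x' \in W.
  have -> : x - x' = \sum_i a i * (xw (y i)).2.
    rewrite xE /x' -sumrB; apply: eq_bigr => i _.
    by have [_ _ yE] := yP i; rewrite {1}yE -mulrBr addrAC subrr add0r.
  elim/big_ind: _ => // [z t zW tW|i _]; first by rewrite -[z]mul1r WD.
  by rewrite -[_ * _]addr0 WD //; case: (yP i).
by rewrite expr2 xW.
Qed.

(** For a suitable a in N, S and B agree modulo a^(k+1). As a^(k+1) lies in N^(k+1), S then meets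
    M^(k+1) in N^(k+1) and maps onto B/M^(k+1). *)
Lemma completion_subring : same_completion v N M.
Proof.
have [a aN aP] : exists2 a, a \in N & forall k,
    (forall b, exists s z, b = v s + v (a ^+ k.+1) * z) /\
    (forall c b, v c = v (a ^+ k.+1) * b -> exists d, c = a ^+ k.+1 * d).
  have [[a0 a0M ra0]|DT] := D_max; last first.
    (* When S is all of B, the element 0 has both properties. *)
    exists 0 => [|k]; first exact: rpred0.
    rewrite exprS mul0r rmorph0; split=> [b|c b]; last first.
      by rewrite mul0r => c0; exists 0; apply: subring_val_inj; rewrite c0 mulr0 rmorph0.
    by have [s <-] := exists_val (DT b); exists s, 0; rewrite mulr0 addr0.
  (* The regular element a0 is moved into S through multiplication by the unit 1 + y. *)
  have [y yM /exists_val[a aE]] := D_dense a0 ra0.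
  have ra k : regular Q (v (a ^+ k)).
    elim: k => [|k IHk] i; first by rewrite rmorph1 idealr1.
    rewrite exprS rmorphM prime_idealrM negb_or IHk andbT.
    rewrite aE -{1}[a0]mulr1 -mulrDr prime_idealrM negb_or ra0 /=.
    by apply/negP => /QM/rpredB/(_ yM); rewrite addrK idealr1.
  exists a => [|k].
    by change (v a \in M); rewrite aE rpredD // mulrC idealMr.
  split=> [b|c b cE]; first by have [s [z [_ ->]]] := val_dense b (ra k.+1); exists s, z.
  by have [d _ ->] := val_div (ra k.+1) cE; exists d.
have aNk k : a ^+ k.+1 \in ideal_powS N k.
  apply: ideal_gen_gen; exists (fun=> a) => //.
  by rewrite prodr_const card_ord.
have vN k s : s \in ideal_powS N k -> v s \in ideal_powS M k.
  move=> /ideal_genP[l [b [y [yN ->]]]]; rewrite rmorph_sum; apply: rpred_sum => i _ /=.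
  rewrite rmorphM idealMr //; apply: ideal_gen_gen; have [z zN <-] := yN i.
  by exists (v \o z); rewrite ?rmorph_prod.
apply: same_completion_powS => k x; last first.
  have [s [z xE]] := (aP k).1 x; exists s.
  by rewrite xE addrC addKr mulrC idealMr // vN.
apply/idP/idP; last exact: vN.
have [dense divs] := aP k; set ak := a ^+ k.+1 in dense divs.
have akN : ak \in ideal_powS N k by apply: aNk.
move=> /ideal_genP[l [b [y [yM xE]]]].
(* Replacing each factor in M by an element of S modulo a^(k+1) keeps it in M, hence in N; so x is
   congruent to some t in N^(k+1). *)
have [t tN [w tw]] : exists2 t, t \in ideal_powS N k & exists w, v x = v t + v ak * w.
  rewrite xE; elim/big_ind: _ => [|u u' [t tN [w ->]] [t' t'N [w' ->]]|i _].
  - by exists 0; [exact: rpred0|exists 0; rewrite mulr0 addr0 rmorph0].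
  - by exists (t + t'); [exact: rpredD|exists (w + w'); rewrite rmorphD mulrDr addrACA].
  have [z zM <-] := yM i.
  have /choice[c cP] : forall j, exists c : S * B, z j = v c.1 + v ak * c.2.
    by move=> j; have [s [w ->]] := dense (z j); exists (s, w).
  have cN j : (c j).1 \in N.
    change (v (c j).1 \in M); rewrite -(addrK (v ak * (c j).2) (v _)) -cP.
    by rewrite rpredB ?zM // mulrC idealMr //; exact: (ideal_powS_sub (vN _ _ akN)).
  have [w zw] : exists w, \prod_j z j = v (\prod_j (c j).1) + v ak * w.
    rewrite rmorph_prod; elim/big_ind2: _ => [|u _ t _ [w ->] [w' ->]|j _].
    - by exists 0; rewrite mulr0 addr0.
    - exists (u * w' + w * (t + v ak * w')).
      by rewrite mulrDl (mulrDr u) (mulrDr (v ak)) -addrA (mulrCA u) (mulrA (v ak) w).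
    - by exists (c j).2.
  have [s [w' bE]] := dense (b i).
  exists (s * \prod_j (c j).1).
    by apply: idealMr; apply: ideal_gen_gen; exists (fun j => (c j).1).
  exists (v s * w + w' * \prod_j z j); rewrite bE mulrDl {1}zw mulrDr rmorphM.
  by rewrite -addrA mulrDr (mulrCA (v s)) -(mulrA (v ak)).
have [d xd] : exists d, x - t = ak * d.
  by apply: (divs _ w); rewrite rmorphB tw addrC addKr.
by rewrite -(subrK t x) xd rpredD // mulrC idealMr.
Qed.

Lemma contr_prime (P : {pred B}) : prime_ideal P -> prime_ideal (ideal_contr v P).
Proof.
move=> /prime_idealP[P' ->]; split; first exact: ideal_contr_idealr_closed.
move=> x y; change (v (x * y) \in P' -> (v x \in P') || (v y \in P')).
by rewrite rmorphM prime_idealrM.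
Qed.

(** If p contains a regular a, then S/aS = B/aB makes pB a prime contracting to p. Otherwise p omits
    exactly one separator e_j, and p is the contraction of any minimal prime of class j. *)
Lemma contr_surj (p : {pred S}) : prime_ideal p ->
  exists2 P, prime_ideal P & ideal_contr v P = p.
Proof.
move=> /prime_idealP[p' ->] {p}; move: p' => p.
have cp : idealr_closed p.
  by split; rewrite ?rpred0 ?idealr1 // => a x y xp yp; rewrite rpredD ?idealMr.
have [[a ap ra]|noreg] := pselect (exists2 a, a \in p & regular Q (v a)).
  pose P := ideal_ext v p.
  have Pp s : v s \in P -> s \in p.
    move=> /(ext_contr_mod ra)[d /(ideal_gen_sub cp) sp].
    rewrite -(subrK (a * d) s) rpredD ?sp //.
    by rewrite mulrC idealMr.
  have pP s : s \in p -> v s \in P by move=> sp; apply: ideal_gen_gen; exists s.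
  have P1 : 1 \notin P by rewrite -(rmorph1 v); apply/negP => /Pp; rewrite idealr1.
  have cP : idealr_closed P := ideal_gen_closed P1.
  have [J PJ] := idealr_closedP cP.
  have aJ : v a \in J by rewrite -PJ; apply: pP.
  have mod b : exists2 s, v s \in P = (b \in P) & exists z, b = v s + v a * z.
    have [s [z [_ bE]]] := val_dense b ra; exists s; last by exists z.
    by rewrite bE PJ rpredDr // mulrC idealMr.
  exists P.
    split=> //.
    move=> x y; have [s sx [z xE]] := mod x; have [t ty [w yE]] := mod y.
    have -> : (x * y \in P) = (v (s * t) \in P).
      rewrite PJ xE mulrDl rpredDr; last by rewrite -mulrA mulrC idealMr.
      rewrite yE mulrDr rmorphM rpredDr // mulrCA mulrC idealMr //.
    by move=> /Pp; rewrite prime_idealrM -sx -ty => /orP[/pP ->|/pP ->]; rewrite ?orbT.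
  by apply/funext => s; apply/idP/idP; [apply: Pp|apply: pP].
have [e eP] := val_separator.
(* The sum of all e_j is regular, so p cannot contain every e_j. *)
have [j ej] : exists j, e j \notin p.
  apply: contrapT => noj; apply: noreg; exists (\sum_j e j).
    apply: rpred_sum => j _; apply: contrapT => /negP ejp.
    by apply: noj; exists j.
  move=> i; rewrite rmorph_sum (bigD1 (cl i)) //=; set z := \sum_(_ | _) _.
  have zQ : z \in Q i by apply: rpred_sum => j jc; rewrite eP eq_sym.
  by apply/negP => /rpredB/(_ zQ); rewrite addrK eP eqxx.
have ejk k : k != j -> e k \in p.
  move=> kj; have : e k * e j \in p.
    suff -> : e k * e j = 0 by apply: rpred0.
    apply: subring_val_inj; rewrite rmorph0; apply: Q_cap => i; rewrite rmorphM prime_idealrM !eP.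
    by case: eqVneq => //= ->.
  by rewrite prime_idealrM (negPf ej) orbF.
have [i ij] := cl_surj j; exists (Q i : {pred B}).
  split; last by move=> x y; rewrite prime_idealrM.
  by split; rewrite ?rpred0 ?idealr1 // => a x y xp yp; rewrite rpredD ?idealMr.
apply/funext => x; apply/idP/idP => [xQ|xp].
  have : x * e j \in p.
    suff -> : x * e j = 0 by apply: rpred0.
    apply: subring_val_inj; rewrite rmorph0; apply: Q_cap => k; rewrite rmorphM prime_idealrM eP.
    have [kj|] := eqVneq (cl k) j; last by rewrite orbT.
    by rewrite (D_class (subring_valP x) _ xQ) // ij.
  by rewrite prime_idealrM (negPf ej) orbF.
(* If x were outside Q_i, then x e_j plus the other separators would be a regular element of p. *)
apply: contrapT => /negP xQ; apply: noreg.
exists (x * e j + \sum_(k | k != j) e k).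
  by rewrite rpredD ?rpred_sum // mulrC idealMr.
move=> k; rewrite rmorphD rmorph_sum /=; have [kj|kj] := eqVneq (cl k) j.
  set z := \sum_(_ | _) _; have zQ : z \in Q k.
    by apply: rpred_sum => l lj; rewrite eP kj eq_sym.
  apply/negP => /rpredB/(_ zQ); rewrite addrK rmorphM prime_idealrM eP kj eqxx orbF.
  apply/negP; apply: contra xQ => xk; change (v x \in Q i).
  by apply: D_class xk; rewrite ?subring_valP // ij.
rewrite (bigD1 (cl k)) //= addrCA; set z := v (x * e j) + _; have zQ : z \in Q k.
  rewrite /z rpredD //; first by rewrite rmorphM prime_idealrM eP kj orbT.
  by apply: rpred_sum => l /andP[_ lk]; rewrite eP eq_sym.
by apply/negP => /rpredB/(_ zQ); rewrite addrK eP eqxx.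
Qed.

(** A unit multiple s of a lies in S. Each x in P is t + sz with t in S, and both s and t lie in the
    contraction of P. *)
Lemma ext_contr (P : prime_idealr B) a : a \in P -> regular Q a ->
  ideal_ext v (ideal_contr v P) =i P.
Proof.
move=> aP ra x; apply/idP/idP.
  apply: ideal_gen_sub; last by move=> _ [s sP <-].
  by split; rewrite ?rpred0 ?idealr1 // => b y z xp yp; rewrite rpredD ?idealMr.
have [y yM /exists_val[s sE]] := D_dense a ra.
have rs : regular Q (v s).
  move=> i; rewrite sE -{1}[a]mulr1 -mulrDr prime_idealrM negb_or ra /=.
  by apply/negP => /QM/rpredB/(_ yM); rewrite addrK idealr1.
have sP : v s \in P by rewrite sE rpredD // mulrC idealMr.
have [t [z [_ ->]]] := val_dense x rs => xP.
have tP : v t \in P by rewrite -(addrK (v s * z) (v t)) rpredB // mulrC idealMr.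
by rewrite addrC mulrC; apply: ideal_genD; apply: ideal_gen_gen; [exists s|exists t].
Qed.

End GluedSubring.

(** * Rationals, residue fields and the construction of S *)

Lemma injectsP (T U : Type) : injects T U <-> [set: T] #<= [set: U].
Proof.
split=> [[f fI]|/card_leP[f]].
  have /injfunPex[g] : exists2 f : T -> U, set_fun [set: T] [set: U] f & set_inj [set: T] f.
    by exists f => // x y _ _; apply: fI.
  exact: inj_card_le g.
exists (fun x => val (f (SigSub (mem_set (I : [set: T] x))))) => x y /val_inj fxy.
by have /(congr1 val) := inj (mem_set I) (mem_set I) fxy.
Qed.

Lemma subring_subtype (B : comNzRingType) (D : {pred B}) :
  subring_closed D -> exists S : subComNzRingType D, True.
Proof.
move=> cD; pose h := GRing.SubChoice_isSubComNzRing.Build B D {x : B | D x} cD.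
by exists (HB.pack_for (subComNzRingType D) {x : B | D x} h).
Qed.

Lemma int_unit (B : comNzRingType) (g : {rmorphism rat -> B}) (k : int) :
  k != 0 -> exists y : B, k%:~R * y = 1.
Proof.
move=> k0; exists (g (k%:~R^-1)); rewrite -(rmorph_int g) -rmorphM divff ?rmorph1 //.
by rewrite intr_eq0.
Qed.

(** A rational times its denominator is an integer, hence in [D]; the denominator is a unit of B, so
    division stays in [D]. *)
Lemma contains_rationals_sub (B : comNzRingType) (n : nat) (Q : 'I_n -> prime_idealr B)
    (D : {pred B}) (S : subComNzRingType D) :
  (forall a b, a \in D -> regular Q a -> a * b \in D -> b \in D) ->
  contains_rationals B -> contains_rationals S.
Proof.
move=> D_div [g gI]; pose v : {rmorphism S -> B} := \val.
have vI : injective v by exact: val_inj.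
have intD (k : int) : (k%:~R : B) \in D by rewrite -(rmorph_int v); exact: valP.
have /choice[h hE] : forall x, exists s, v s = g x.
  move=> x; have [y yE] := int_unit g (denq_neq0 x).
  have gD : g x \in D.
    apply: (D_div (denq x)%:~R) => [//|i|].
      by apply/negP => dQ; have := idealr1 (Q i); rewrite -yE mulrC idealMr.
    by rewrite -(rmorph_int g) -rmorphM mulrC -numqE rmorph_int.
  by exists (Sub (g x) gD : S); exact: SubK.
have h0 : zmod_morphism h by move=> x y; apply: vI; rewrite rmorphB !hE rmorphB.
have h1 : monoid_morphism h.
  by split=> [|x y]; apply: vI; rewrite ?rmorph1 ?rmorphM !hE ?rmorph1 ?rmorphM.
pose H0 := GRing.isZmodMorphism.Build _ _ h h0.
pose H1 := GRing.isMonoidMorphism.Build _ _ h h1.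
exists (HB.pack_for {rmorphism rat -> S} h H0 H1) => x y hxy; apply: gI.
by rewrite -!hE; exact: (congr1 v hxy).
Qed.

Lemma residue_injects (B S : comNzRingType) (v : {rmorphism S -> B}) (M : idealr B) :
  (forall b, exists s, b - v s \in M) ->
  injects {ideal_quot M} {ideal_quot (ideal_contr v M : idealr S)}.
Proof.
move=> dense; have /choice[s sP] := fun u : {ideal_quot M} => dense (repr u).
exists (fun u => \pi_{ideal_quot (ideal_contr v M : idealr S)} (s u)) => u u' /eqP.
rewrite -Quotient.idealrBE => suu.
rewrite -[u]reprK -[u']reprK; apply/eqP; rewrite -Quotient.idealrBE.
have {suu} : v (s u) - v (s u') \in M by rewrite -rmorphB.
move=> /rpredD/(_ (sP u)); rewrite addrC addrA subrK => /rpredB/(_ (sP u')).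
by rewrite opprB addrA addrNK.
Qed.

Lemma dense_subring (B : comNzRingType) (M : idealr B) (n : nat)
    (Q : 'I_n -> prime_idealr B) :
  (forall x, x \notin M -> exists y, x * y = 1) ->
  (forall i, {subset Q i <= M}) ->
  (forall i k, i != k -> exists2 x, x \in Q k & x \notin Q i) ->
  (forall x, (forall i, x \in Q i) -> x = 0) ->
  contains_rationals B -> ~ injects {ideal_quot M} nat -> injects B {ideal_quot M} ->
  exists R : subringClosed B,
    [/\ forall i z, z \in R -> z \in Q i -> z = 0,
        forall a b, regular Q a -> exists2 y, y \in M & b + a * y \in R
      & (exists2 a, a \in M & regular Q a) \/ forall b, b \in R].
Proof.
move=> unitM QM Q_sep Q_cap [g gI] KN BK.
have [[c cM rc]|noreg] := pselect (exists2 a, a \in M & regular Q a).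
  have [|R [R_cap R_dense]] := generic_subring QM KN BK _ cM rc.
    move=> i k kQ; have [->|/(int_unit g)[y ky]] := eqVneq k 0; first exact: rmorph0.
    by have := idealr1 (Q i); rewrite -ky mulrC idealMr.
  by exists R; split=> //; left; exists c.
(* Without regular elements in M, the ring B itself is taken for R. *)
have genT b : b \in (gen_ring (@id B) : subringClosed B).
  exact: (gen_ring_gen (@id B)).
exists (gen_ring (@id B) : subringClosed B); split; last by right.
  have [P PM] : exists P : prime_idealr B, M = P :> {pred B}.
    apply: prime_idealP; split.
      by split; rewrite ?rpred0 ?idealr1 // => a x y xp yp; rewrite rpredD ?idealMr.
    move=> x y xyM; have [//|/unitM[z xz]] := boolP (x \in M).
    have -> : y = z * (x * y) by rewrite mulrA [z * x]mulrC xz mul1r.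
    exact: idealMr.
  (* By prime avoidance M lies in some Q_i, which is then the only minimal prime and therefore 0. *)
  have [i MQ] : exists i, {subset M <= Q i}.
    apply: contrapT => /forallNP noQ; apply: noreg; rewrite PM.
    by apply: regular_in => // i; rewrite -PM.
  have all_i k : k = i.
    apply/eqP/negPn/negP; rewrite eq_sym => /Q_sep[x /QM/MQ xi].
    by rewrite xi.
  by move=> k z _ zk; apply: Q_cap => l; rewrite (all_i l) -(all_i k).
by move=> a b _; exists 0; rewrite ?rpred0.
Qed.

Theorem theorem2p14 (B : comNzRingType) (M : idealr B)
    (B_local : local_ring M) (B_reduced : reduced B)
    (B_rat : contains_rationals B)
    (residue_uncountable : ~ countable [set: {ideal_quot M}])
    (card_B : [set: B] #= [set: {ideal_quot M}])
    (m : nat) (m_gt0 : (1 <= m)%N) (C : 'I_m -> set {pred B})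
    (C_partition : classical_sets.partition [set: 'I_m] C (@MinSpec B)) :
  exists (D : {pred B}) (S : subComNzRingType D),
    let incl : {rmorphism S -> B} := \val in
    let f : {pred B} -> {pred S} := ideal_contr incl in
    let N : idealr S := ideal_contr incl M in
    (local_ring N /\ reduced S) /\
    [/\ contains_rationals S,
        same_completion incl N M,
        ~ countable [set: {ideal_quot N}] /\ [set: S] #= [set: {ideal_quot N}],
        forall Q Q' : {pred B}, MinSpec Q -> MinSpec Q' ->
          (f Q =i f Q' <-> exists i : 'I_m, C i Q /\ C i Q')
      & f @` (@Spec B) = @Spec S /\
        (forall P : {pred B}, Spec P -> (0%:E < height P)%E ->
           ideal_ext incl (f P) =i P) /\
        (forall P P' : {pred B}, Spec P -> Spec P' ->
           (0%:E < height P)%E -> (0%:E < height P')%E ->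
           (0%:E < height (f P))%E /\ (f P =i f P' -> P =i P'))].
Proof.
have unitM x : x \notin M -> exists y, x * y = 1 by apply: local_unit.
have noethB : noetherian B by case: B_local.
have [n [Q [minQ Qmin Q_inj Q_cap]]] := minimal_primes noethB B_reduced.
have QM i : {subset Q i <= M}.
  move=> x xQ; apply: contrapT => /negP/unitM[y xy].
  by have := idealr1 (Q i); rewrite -xy mulrC idealMr.
have Q_sep i k : i != k -> exists2 x, x \in Q k & x \notin Q i.
  move=> ik; apply: contrapT => nox; move/eqP: ik; apply; apply: Q_inj.
  apply/funext => x; apply/esym/((minQ i).2 (Q k) (minQ k).1) => z zk.
  by apply: contrapT => /negP zi; apply: nox; exists z.
have [Ccover Ctriv Cne] := C_partition.
have /choice[cl clC] : forall i, exists j, C j (Q i).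
  move=> i; have : cover [set: 'I_m] C (Q i) by rewrite Ccover.
  by move=> [j _ Cj]; exists j.
have clP i j : C j (Q i) -> cl i = j.
  by move=> Cj; apply: (Ctriv _ _ I I); exists (Q i : {pred B}); split=> //; exact: clC.
have CQ j P : C j P -> exists2 i, P = Q i & cl i = j.
  move=> CjP; have : MinSpec P by rewrite -Ccover; exists j.
  by move=> /Qmin[i PE]; exists i => //; apply: clP; rewrite -PE.
have cl_surj j : exists i, cl i = j.
  by have [P /CQ[i _ ij]] := Cne j I; exists i.
have KN : ~ injects {ideal_quot M} nat by move=> /injectsP.
have BK : injects B {ideal_quot M}.
  by apply/injectsP; move: card_B; rewrite card_eq_le => /andP[].
have [R [R_cap R_dense R_max]] := dense_subring unitM QM Q_sep Q_cap B_rat KN BK.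
pose D := glue Q cl R.
have D_div := @glue_div _ _ _ _ _ R cl_surj R_cap : forall a b, a \in D -> _.
have D_class s i k : s \in D -> cl i = cl k -> s \in Q i -> s \in Q k.
  exact: glue_class.
have D_dense a b : regular Q a -> exists2 y, y \in M & b + a * y \in D.
  exact: glue_dense.
have D_inv x : x \in D -> x \notin M -> exists2 y, y \in D & x * y = 1.
  exact: glue_inv.
have D_sep j : exists2 e, e \in D & forall i, (e \in Q i) = (cl i != j).
  exact: class_separator.
have D_max : (exists2 a, a \in M & regular Q a) \/ forall b, b \in D.
  by have [|RT] := R_max; [left|right=> b; apply: R_glue].
have [S _] : exists S : subComNzRingType D, True.
  by apply: subring_subtype; apply: glue_closed.
exists D, S => incl f N.
(* A chain of positive length puts a prime P0 strictly inside P. If P were inside some Q_i,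
   minimality would force P0 = Q_i, hence P inside P0; so P contains a regular element. *)
have pos P : Spec P -> (0%:E < height P)%E -> exists P' : prime_idealr B,
    [/\ P = P', exists2 a, a \in P' & regular Q a &
      exists2 P0, Spec P0 & {subset P0 <= P} /\ ~ {subset P <= P0}].
  move=> sP /height_gt0P[[//|k] _ [c [cspec cinc cP]]].
  have [P' PP'] := prime_idealP sP; exists P'; split=> //; last first.
    exists (c k); first by apply: cspec.
    have [ck nck] := cinc k (leqnn _).
    split=> [x /ck|Pc]; first by rewrite cP.
    by apply: nck => x; rewrite cP; apply: Pc.
  apply: (regular_in Q_sep) => i P'Q; have [ck] := cinc k (leqnn _); apply=> x.
  rewrite cP PP' => /P'Q; rewrite -((minQ i).2 (c k)) //; first exact: cspec.
  by move=> z /ck; rewrite cP PP'; apply: P'Q.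
have ext P : Spec P -> (0%:E < height P)%E -> ideal_ext incl (f P) =i P.
  move=> sP /(pos _ sP)[P' [-> [a aP ra] _]].
  exact: (ext_contr S QM D_dense aP ra).
have dense b : exists s, b - incl s \in M.
  have [|y yM yD] := @D_dense 1 b; first by move=> i; rewrite idealr1.
  exists (Sub (b + 1 * y) yD : S); rewrite /incl /= SubK.
  by rewrite opprD addrA subrr add0r rpredN mul1r.
have KS := residue_injects dense.
split; first split; first split.
- exact: (quasi_local_subring S D_inv).
- move=> I cI.
  exact: (noetherian_subring noethB B_reduced Q_cap D_div D_class D_dense D_inv D_sep cI).
- move=> x k xk; exact: (reduced_subring B_reduced xk).
split.
- exact: (contains_rationals_sub S D_div B_rat).
- exact: (completion_subring S QM D_div D_dense D_max).
- split.
    by move=> /injectsP KSN; apply: KN; apply: injects_trans KS KSN.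
  (* The inequalities are |S| <= |B| <= |B/M| <= |S/N| <= |S|. *)
  apply: Cantor_Bernstein; apply/injectsP.
    apply: injects_trans KS; apply: injects_trans BK.
    by exists incl; apply: val_inj.
  by exists repr => u u' /(congr1 \pi_{ideal_quot N}); rewrite !reprK.
- move=> P P' /Qmin[i ->] /Qmin[i' ->]; split=> [ff|[j [/clP ij /clP i'j]] s].
    exists (cl i); split; first exact: clC.
    suff -> : cl i = cl i' by exact: clC.
    (* The separator of the class of i lies in Q_i' exactly when i' is in another class. *)
    have [e eD eP] := D_sep (cl i); pose s : S := Sub e eD.
    have : (incl s \in Q i) = (incl s \in Q i') := ff s.
    rewrite /incl /= SubK !eP eqxx => /esym/negbFE/eqP.
    exact: esym.
  change ((incl s \in Q i) = (incl s \in Q i')).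
  by apply/idP/idP; apply: D_class; rewrite ?ij ?i'j //; exact: valP.
split; last split=> //.
  apply/seteqP; split=> [_ [P sP <-]|p sp]; first exact: contr_prime.
  by have [P sP <-] := contr_surj Q_cap cl_surj D_div D_class D_dense D_sep sp; exists P.
move=> P P' sP sP' hP hP'; split.
  have [_ [_ _ [P0 sP0 [P0P PP0]]]] := pos _ sP hP.
  (* The contractions of P0 and P form a chain: if that of P were inside that of P0, extending to B
     would put P inside P0. *)
  apply/height_gt0P; exists 1%N => //; exists (fun i => if i == 0%N then f P0 else f P).
  split=> //.
  - by move=> i _; case: eqP => _; apply: contr_prime.
  - move=> [|//] _ /=; split=> [s|fPP0]; first exact: P0P.
    apply: PP0 => x; rewrite -(ext P sP hP); apply: ideal_gen_sub; first exact: sP0.1.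
    by move=> _ [s sfP <-]; apply: (fPP0 s).
move=> ff x; rewrite -(ext P) // -(ext P') //.
by congr (_ \in ideal_ext _ _); apply/funext => s; exact: ff.
Qed.
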